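(* Suppose $\Lambda$ is a weakly admissible lattice for $(\mathcal{S},C)$, let $Z_{\boldsymbol{Q}}$ be a set as described in the context, and define $c_1:=M\left((1+\kappa)N^{2N}\right)^N$. Then $$\left|\#(Z_{\boldsymbol{Q}}\cap\Lambda)-\frac{\mathrm{Vol}\, Z_{\boldsymbol{Q}}}{\det\Lambda}\right|\leq c_1\inf_{0<B\leq Q_{max}}\left(\frac{\overline{Q}}{\mu(\Lambda,B)}+\frac{Q_{max}}{B}\right)^{N-1}.$$
   Context: Let $n\ge 1$ be an integer, $\boldsymbol{m}=(m_1,\ldots,m_n)$ a tuple of positive integers, $\boldsymbol{\beta}=(\beta_1,\ldots,\beta_n)\in(0,\infty)^n$, $\mathcal{S}=(\boldsymbol{m},\boldsymbol{\beta})$, $N:=\sum_i m_i$ (assumed $>1$), $t:=\sum_i\beta_i$. Elements of $\mathbb{R}^N=\mathbb{R}^{m_1}\times\cdots\times\mathbb{R}^{m_n}$ are written $\underline{\mathbf{x}}=(\mathbf{x}_1,\ldots,\mathbf{x}_n)$ with $\mathbf{x}_i\in\mathbb{R}^{m_i}$; $|\cdot|$ is the Euclidean norm. Put $\mathrm{Nm}_{\boldsymbol{\beta}}(\underline{\mathbf{x}}):=\prod_{i=1}^n|\mathbf{x}_i|^{\beta_i}$. Fix $I\subset\{1,\ldots,n\}$ and let $C=\{\underline{\mathbf{x}}\in\mathbb{R}^N:\mathbf{x}_i=\mathbf{0}\text{ for all }i\in I\}$. For $\Gamma\subset\mathbb{R}^N$ and $\rho>0$ set $\nu(\Gamma,\rho):=\inf\{\mathrm{Nm}_{\boldsymbol{\beta}}(\underline{\mathbf{x}})^{1/t}:\underline{\mathbf{x}}\in\Gamma\setminus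 C,\ |\underline{\mathbf{x}}|<\rho\}$, $\lambda_1(\Gamma):=\inf\{|\underline{\mathbf{x}}|:\underline{\mathbf{x}}\in\Gamma\setminus\{\mathbf{0}\}\}$, $\mu(\Gamma,\rho):=\min\{\lambda_1(\Gamma\cap C),\nu(\Gamma,\rho)\}$, with $\inf\emptyset=\infty$; if $\mu(\Gamma,\rho)=\infty$ then $1/\mu(\Gamma,\rho)$ is interpreted as $0$. A lattice in $\mathbb{R}^N$ always has rank $N$. A lattice $\Lambda$ in $\mathbb{R}^N$ is weakly admissible for $(\mathcal{S},C)$ if $\nu(\Lambda,\rho)>0$ for all $\rho>0$. Let $\boldsymbol{Q}=(Q_1,\ldots,Q_n)\in(0,\infty)^n$, $\overline{Q}:=\left(\prod_{i=1}^nQ_i^{\beta_i}\right)^{1/t}$, $Q_{max}:=\max_iQ_i$, and assume $Q_i\le\overline{Q}$ for all $i\notin I$. For a positive integer $M$ and real $L\ge 0$, a set $S\subset\mathbb{R}^D$ ($D\geq 2$) is in Lip$(D,M,L)$ if there are $M$ maps $\phi_1,\ldots,\phi_M:[0,1]^{D-1}\to\mathbb{R}^D$ with $|\phi_i(\mathbf{x})-\phi_i(\mathbf{y})|\le L|\mathbf{x}-\mathbf{y}|$ for all $\mathbf{x},\mathbf{y}\in[0,1]^{D-1}$, whose images cover $S$. For $\kappa>0$ and a positive integer $M$ let $\mathcal{F}_{\kappa,M}$ be the family of sets $S\subset\mathbb{R}^N$ such that $\partial(AS)\in$ Lip$(N,M,\kappa\cdot\mathrm{diam}(AS))$ for all $A\in\mathrm{GL}_N(\mathbb{R})$,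 where $\partial$ is the topological boundary and $\mathrm{diam}$ the diameter. Fix $\kappa>0$ and a positive integer $M$. $Z_{\boldsymbol{Q}}\subset\mathbb{R}^N$ denotes a set such that (1) $Z_{\boldsymbol{Q}}\in\mathcal{F}_{\kappa,M}$, and (2) for each $1\le i\le n$ there is $\mathbf{y}_i\in\mathbb{R}^{m_i}$ such that $\pi_i(Z_{\boldsymbol{Q}})$ is contained in the closed Euclidean ball in $\mathbb{R}^{m_i}$ of radius $Q_i$ about $\mathbf{y}_i$, where $\pi_i(\underline{\mathbf{x}})=\mathbf{x}_i$. (Such a set is measurable.) *)

(* Defs.v *)
From mathcomp Require Import all_boot all_order all_algebra.
From mathcomp Require Import all_classical all_reals all_analysis.

Set Implicit Arguments.
Unset Strict Implicit.
Unset Printing Implicit Defensive.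

Import Order.TTheory GRing.Theory Num.Theory.
Import numFieldNormedType.Exports.

Local Open Scope classical_set_scope.
Local Open Scope ring_scope.

(* R^D is 'rV[R]_D.  The norm that MathComp-Analysis puts on 'rV[R]_D is the
   sup norm, so the Euclidean norm is defined here; the topology (coordinatewise
   convergence) is the Euclidean one. *)

Definition enorm (R : realType) (D : nat) (x : 'rV[R]_D) : R :=
  Num.sqrt (\sum_(i < D) x ord0 i ^+ 2).

(* The maximum with 0 only matters for S = set0, whose diameter is 0. *)
Definition diam (R : realType) (D : nat) (S : set 'rV[R]_D) : \bar R :=
  maxe 0%E
    (ereal_sup [set d | exists x y, [/\ S x, S y & d = (enorm (x - y))%:E]]).

Definition boundary (T : topologicalType) (S : set T) : set T :=
  closure S `\` interior S.

Definition unit_cube (R : realType) (d : nat) : set 'rV[R]_d :=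
  [set x | forall i, 0 <= x ord0 i <= 1].

Definition Lip (R : realType) (D M : nat) (L : R) (S : set 'rV[R]_D) : Prop :=
  exists phi : 'I_M -> 'rV[R]_D.-1 -> 'rV[R]_D,
    (forall k x y, unit_cube x -> unit_cube y ->
       enorm (phi k x - phi k y) <= L * enorm (x - y)) /\
    S `<=` \bigcup_k (phi k @` @unit_cube R D.-1).

(* GL_D(R) acts on row vectors on the right.  Since the Lipschitz constant
   kappa * diam (A S) has to be a real number, diam (A S) is required to be
   finite. *)
Definition lip_family (R : realType) (D : nat) (kappa : R) (M : nat)
    (S : set 'rV[R]_D) : Prop :=
  forall A : 'M[R]_D, A \in unitmx ->
    let AS := (fun x : 'rV[R]_D => x *m A) @` S in
    diam AS \is a fin_num /\
    Lip M (kappa * fine (diam AS)) (boundary AS).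

Definition box (R : realType) (D : nat) (a b : 'rV[R]_D) : set 'rV[R]_D :=
  [set x | forall i, a ord0 i < x ord0 i <= b ord0 i].

(* Lebesgue outer measure; on Lebesgue measurable sets it is the volume. *)
Definition vol (R : realType) (D : nat) (S : set 'rV[R]_D) : \bar R :=
  ereal_inf [set v | exists a b : nat -> 'rV[R]_D,
    [/\ forall k i, a k ord0 i <= b k ord0 i,
        S `<=` \bigcup_k box (a k) (b k) &
        v = (\sum_(0 <= k <oo) (\prod_(i < D) (b k ord0 i - a k ord0 i))%:E)%E]].

(* The rows of A form a basis of R^D whose integer combinations are G. *)
Definition lattice_basis (R : realType) (D : nat) (G : set 'rV[R]_D)
    (A : 'M[R]_D) : Prop :=
  A \in unitmx /\ G = range (fun z : 'rV[int]_D => map_mx intr z *m A).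

Definition is_lattice (R : realType) (D : nat) (G : set 'rV[R]_D) : Prop :=
  exists A, lattice_basis G A.

(* The value does not depend on the basis chosen by xget; the default 1%:M is
   used only when G is not a lattice. *)
Definition det_lattice (R : realType) (D : nat) (G : set 'rV[R]_D) : R :=
  `|\det (xget 1%:M (lattice_basis G))|.

(* R^N = R^(m_1) x ... x R^(m_n) is 'rV[R]_(\sum_i m i), and the i-th component
   of x is submxrow x i. *)

Definition Nm (R : realType) (n : nat) (m : 'I_n -> nat) (beta : 'I_n -> R)
    (x : 'rV[R]_(\sum_i m i)) : R :=
  \prod_(i < n) (enorm (submxrow x i) `^ beta i).

Definition Cset (R : realType) (n : nat) (m : 'I_n -> nat) (I : {set 'I_n}) :
    set 'rV[R]_(\sum_i m i) :=
  [set x | forall i, i \in I -> submxrow x i = 0].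

Definition nu (R : realType) (n : nat) (m : 'I_n -> nat) (beta : 'I_n -> R)
    (I : {set 'I_n}) (G : set 'rV[R]_(\sum_i m i)) (rho : R) : \bar R :=
  ereal_inf [set (Nm beta x `^ (\sum_i beta i)^-1)%:E |
             x in (G `\` @Cset R n m I) `&` [set x | enorm x < rho]].

Definition lambda1 (R : realType) (D : nat) (G : set 'rV[R]_D) : \bar R :=
  ereal_inf [set (enorm x)%:E | x in G `\ 0].

Definition mu (R : realType) (n : nat) (m : 'I_n -> nat) (beta : 'I_n -> R)
    (I : {set 'I_n}) (G : set 'rV[R]_(\sum_i m i)) (rho : R) : \bar R :=
  mine (lambda1 (G `&` @Cset R n m I)) (nu beta I G rho).

Definition weakly_admissible (R : realType) (n : nat) (m : 'I_n -> nat)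
    (beta : 'I_n -> R) (I : {set 'I_n}) (G : set 'rV[R]_(\sum_i m i)) : Prop :=
  is_lattice G /\ forall rho : R, 0 < rho -> (0 < nu beta I G rho)%E.

Definition Qbar (R : realType) (n : nat) (beta Q : 'I_n -> R) : R :=
  (\prod_(i < n) (Q i `^ beta i)) `^ (\sum_i beta i)^-1.

(* The base value 0 is harmless: Q is positive and n >= 1 in the theorem. *)
Definition Qmax (R : realType) (n : nat) (Q : 'I_n -> R) : R :=
  \big[Num.max/0]_(i < n) Q i.

Definition c1 (R : realType) (N M : nat) (kappa : R) : R :=
  M%:R * ((1 + kappa) * N%:R ^+ (2 * N)) ^+ N.

(* Main.v *)
(* Let T scale the i-th block by Qbar / Q_i, so that T Z lies in a product of
   balls of radius Qbar and has diameter O(Qbar).  A nonzero point y of Lambda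
   satisfies |T y| >= Qbar / X with X = Qbar / mu(Lambda, B) + Qmax / B: if y is
   in C then T does not shrink y; if y is not in C and |y| < B, then |T y|
   dominates every |(T y)_i|, hence their weighted geometric mean, which is
   Nm(y)^(1/t) since the weighted product of the scaling factors is 1; if
   |y| >= B then |T y| >= (Qbar / Qmax) B.
   A reduced basis of T Lambda therefore turns T Z into a set S of diameter
   O(X), and Lambda into Z^N.  The number of integer points in S and its volume
   both lie between the number of unit cells contained in S and the number of
   those meeting S; the two numbers differ by at most the number of cells meeting
   the boundary of S, which the Lipschitz parametrisation bounds by O(X^(N-1)). *)
From HB Require Import structures.
Require Import Defs.
From mathcomp Require Import all_boot all_order all_algebra perm finmap.
From mathcomp Require Import all_classical all_reals all_analysis.
From mathcomp Require Import measurable_realfun ring lra zify.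

Set Implicit Arguments.
Unset Strict Implicit.
Unset Printing Implicit Defensive.

Import Order.TTheory GRing.Theory Num.Theory.
Import numFieldNormedType.Exports.

Local Open Scope classical_set_scope.
Local Open Scope ring_scope.

(** * Reduced bases *)

Definition sqn (R : realType) (D : nat) (x : 'rV[R]_D) : R :=
  \sum_(i < D) x ord0 i ^+ 2.

Definition dotr (R : realType) (D : nat) (x y : 'rV[R]_D) : R :=
  \sum_(i < D) x ord0 i * y ord0 i.

Lemma sqn_ge0 (R : realType) D (x : 'rV[R]_D) : 0 <= sqn x.
Proof. by apply: sumr_ge0 => i _; rewrite sqr_ge0. Qed.

Lemma sqr_le_sqn (R : realType) D (x : 'rV[R]_D) i : x ord0 i ^+ 2 <= sqn x.
Proof.
by rewrite /sqn (bigD1 i)//= lerDl; apply: sumr_ge0 => j _; rewrite sqr_ge0.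
Qed.

Lemma sqn_eq0 (R : realType) D (x : 'rV[R]_D) : sqn x = 0 -> x = 0.
Proof.
move=> x0; apply/rowP => i; rewrite mxE; apply/eqP; rewrite -sqrf_eq0.
by rewrite eq_le sqr_ge0 andbT -x0 sqr_le_sqn.
Qed.

Lemma sqn0 (R : realType) D : sqn (0 : 'rV[R]_D) = 0.
Proof. by rewrite /sqn big1// => i _; rewrite mxE expr0n. Qed.

Lemma sqnZ (R : realType) D (c : R) (x : 'rV[R]_D) : sqn (c *: x) = c ^+ 2 * sqn x.
Proof. by rewrite /sqn mulr_sumr; apply: eq_bigr => i _; rewrite mxE exprMn. Qed.

Lemma sqnD_orth (R : realType) D (c : R) (x y : 'rV[R]_D) : dotr y x = 0 ->
  sqn (c *: x + y) = c ^+ 2 * sqn x + sqn y.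
Proof.
move=> xy; transitivity (c ^+ 2 * sqn x + sqn y + 2 * c * dotr y x).
  rewrite /sqn /dotr !mulr_sumr -!big_split/=; apply: eq_bigr => i _.
  by rewrite !mxE; ring.
by rewrite xy mulr0 addr0.
Qed.

Lemma dotr_mulmx (R : realType) k D (x : 'rV[R]_k) (A : 'M[R]_(k, D)) y :
  dotr (x *m A) y = \sum_i x ord0 i * dotr (row i A) y.
Proof.
rewrite /dotr; under eq_bigr do rewrite mxE mulr_suml.
rewrite exchange_big/=; apply: eq_bigr => i _.
by rewrite mulr_sumr; apply: eq_bigr => j _; rewrite !mxE mulrA.
Qed.

Lemma nearest_int (R : realType) (r : R) :
  exists n : int, (r - n%:~R) ^+ 2 <= (1 / 4 : R).
Proof.
exists (Num.floor (r + 1 / 2)).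
have /andP[h1 h2] := real_floor_itv (num_real (r + 1 / 2)).
move: h2; rewrite intrD => h2.
have [x0|x0] := leP 0 (r - (Num.floor (r + 1 / 2))%:~R); nra.
Qed.

(** In the Smith normal form of a single row the left factor is 1 x 1 and the diagonal part has one
    entry that can be nonzero, so only the first row of the right unimodular factor survives. *)
Lemma int_row_completion k (z : 'rV[int]_k.+1) :
  exists V : 'M[int]_k.+1, V \in unitmx /\
    exists c : int, z = c *: row ord0 V.
Proof.
have [L _ [V Vu [d _ zE]]] := int_Smith_normal_form z.
exists V; split => //; exists (L ord0 ord0 * d`_0).
rewrite zE -mulmxA (mx11_scalar L) mul_scalar_mx !mxE/= mulr1n -scalerA.
congr (_ *: _); apply/rowP => j; rewrite !mxE big_ord_recl !mxE/= mulr1n.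
by rewrite big1 ?addr0// => i _; rewrite !mxE/= mulr0n mul0r.
Qed.

(** Equal to (k + 1)!: passing from k to k + 1 basis vectors costs the factor k + 2 of
    [reduction_step_le]. *)
Fixpoint reduction_const (k : nat) : nat :=
  if k is k'.+1 then (k'.+2 * reduction_const k')%N else 1%N.

(** Cauchy-Schwarz combined with |w|^2 <= k/4, by induction on [k]. *)
Lemma dotr_sqr_le (R : realType) k (x w : 'rV[R]_k) :
  (forall i, w ord0 i ^+ 2 <= 1 / 4) ->
  dotr x w ^+ 2 <= k%:R / 4 * sqn x.
Proof.
move=> hw; elim: k => [|k IH] in x w hw *.
  by rewrite /dotr /sqn !big_ord0 expr0n/= mulr0.
have := IH (\row_i x ord0 (lift ord0 i)) (\row_i w ord0 (lift ord0 i)).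
rewrite /dotr /sqn !big_ord_recl.
under eq_bigr do rewrite !mxE.
under [\sum_(i < k) _ ^+ 2]eq_bigr do rewrite !mxE.
set D := \sum_i _; set S := \sum_i _ => {IH}IH.
have {}IH : D ^+ 2 <= k%:R / 4 * S by apply: IH => i; rewrite mxE.
have := hw ord0; set a := x _ _; set b := w _ _ => hb.
have S0 : 0 <= S by apply: sumr_ge0 => i _; rewrite sqr_ge0.
(* The weighted AM-GM inequality below divides by k, so k = 0 is treated apart. *)
have [k0|k0] := posnP k.
  have D0 : D = 0 by apply/eqP; rewrite -sqrf_eq0 eq_le sqr_ge0 andbT (le_trans IH)// k0 !mul0r.
  rewrite D0 k0 addr0; have : 0 <= a ^+ 2 by rewrite sqr_ge0.
  by move=> ?; rewrite exprMn; nra.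
have kp : 0 < k%:R :> R by rewrite ltr0n.
rewrite -natr1; set n := k%:R in IH kp *.
(* AM-GM: 2 ab D <= n (ab)^2 + D^2 / n *)
have h : 2 * (a * b) * D <= n * (a * b) ^+ 2 + D ^+ 2 / n.
  rewrite -subr_ge0.
  suff -> : n * (a * b) ^+ 2 + D ^+ 2 / n - 2 * (a * b) * D = n * (a * b - D / n) ^+ 2.
    by rewrite mulr_ge0 ?sqr_ge0// ltW.
  by field; rewrite gt_eqF.
have h1 : D ^+ 2 / n <= S / 4.
  by rewrite ler_pdivrMr//; lra.
have h2 : (a * b) ^+ 2 <= a ^+ 2 / 4.
  by rewrite exprMn ler_wpM2l ?sqr_ge0//; lra.
have h3 : n * (a * b) ^+ 2 <= n * (a ^+ 2 / 4) by rewrite ler_pM2l.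
rewrite sqrrD; rewrite -mulr_natl; lra.
Qed.

Lemma mulmx_row_col_mx (R : realType) k D (x : 'rV[R]_(1 + k)) (a : 'rV[R]_D) (B : 'M[R]_(k, D)) :
  x *m col_mx a B = x ord0 ord0 *: a + rsubmx x *m B.
Proof.
rewrite -{1}[x]hsubmxK mul_row_col; congr (_ + _).
rewrite (mx11_scalar (lsubmx x)) mul_scalar_mx mxE; congr (x _ _ *: _).
exact/val_inj.
Qed.

Lemma sqn_row_mx (R : realType) k (x : 'rV[R]_(1 + k)) :
  sqn x = x ord0 ord0 ^+ 2 + sqn (rsubmx x).
Proof.
rewrite /sqn big_ord_recl; congr (_ + _); apply: eq_bigr => i _.
by rewrite mxE; congr (x _ _ ^+ 2); apply/val_inj.
Qed.

(** The infimum of the squared lengths is positive, so some vector comes within a factor 4/3 of it,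
    whether or not it is attained. Replacing that vector by the primitive one of which it is a
    nonzero integer multiple does not lengthen it. *)
Lemma short_primitive_row (R : realType) k D (A : 'M[R]_(k.+1, D)) (mu : R) :
  0 < mu ->
  (forall z : 'rV[int]_k.+1, z != 0 -> mu <= sqn (map_mx intr z *m A)) ->
  exists V : 'M[int]_k.+1, V \in unitmx /\
    forall z : 'rV[int]_k.+1, z != 0 ->
      3 / 4 * sqn (map_mx intr (row ord0 V) *m A) <= sqn (map_mx intr z *m A).
Proof.
move=> mu0 hmu.
pose E := [set sqn (map_mx intr z *m A) | z in [set z : 'rV[int]_k.+1 | z != 0]].
have E0 : E !=set0.
  exists (sqn (map_mx intr (const_mx 1 : 'rV[int]_k.+1) *m A)); exists (const_mx 1) => //=.
  by apply/eqP => /rowP /(_ ord0); rewrite !mxE.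
have lbE : lbound E mu by move=> _ [z /= z0 <-]; exact: hmu.
have infE : has_inf E by split => //; exists mu.
have mE : mu <= inf E by exact: lb_le_inf.
have e0 : 0 < inf E / 3 by rewrite divr_gt0// (lt_le_trans mu0).
have [_ [z /= z0 <-] hz] := inf_adherent e0 infE.
have [V [Vu [c zE]]] := int_row_completion z.
exists V; split => // y y0.
have hy : inf E <= sqn (map_mx intr y *m A).
  by apply: ge_inf; [exists mu | exists y].
have c0 : c != 0 by apply: contraNneq z0 => c0; rewrite zE c0 scale0r.
have : sqn (map_mx intr (row ord0 V) *m A) <= sqn (map_mx intr z *m A).
  have -> : map_mx intr z = c%:~R *: map_mx intr (row ord0 V) :> 'rV[R]_k.+1.
    by rewrite zE; apply/rowP => i; rewrite !mxE intrM.
  rewrite -scalemxAl sqnZ ler_peMl ?sqn_ge0//.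
  rewrite -[c%:~R ^+ 2]rmorphXn/= ler1z.
  by rewrite -gtz0_ge1 exprn_even_gt0.
lra.
Qed.

Lemma mulmx_unit_neq0 k (z : 'rV[int]_k) (V : 'M[int]_k) :
  V \in unitmx -> z != 0 -> z *m V != 0.
Proof. by move=> Vu; apply: contra_neq => zV; rewrite -(mulmxK Vu z) zV mul0mx. Qed.

(** The arithmetic of the induction step of [reduced_basis]: [g] is the squared length of the first
    basis vector, [X] its coordinate, [d] the shift of that coordinate caused by the other basis
    vectors, [n] the squared length of the other coordinates, and [q] the squared length of the part
    orthogonal to the first vector. Recovering [X] from [X + d] costs 2 d^2, which is at most kr n /
    2. *)
Lemma reduction_step_le (R : realType) (mu g X d n q K kr : R) :
  mu <= g -> 0 < g -> g / 2 * n <= K * q -> d ^+ 2 <= kr / 4 * n ->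
  0 <= q -> 0 <= n -> 1 <= K -> 0 <= kr ->
  mu * (X ^+ 2 + n) <= (kr + 2) * K * ((X + d) ^+ 2 * g + q).
Proof.
move=> gmu g0 hq hd q0 n0 K1 k0.
have hX : X ^+ 2 <= 2 * (X + d) ^+ 2 + 2 * d ^+ 2.
  rewrite -subr_ge0 (_ : _ - _ = (X + 2 * d) ^+ 2) ?sqr_ge0//; ring.
apply: (@le_trans _ _ (g * (X ^+ 2 + n))).
  by rewrite ler_wpM2r// addr_ge0// sqr_ge0.
apply: (@le_trans _ _ (2 * ((X + d) ^+ 2 * g) + (kr + 2) * (g / 2 * n))).
  have -> : 2 * ((X + d) ^+ 2 * g) + (kr + 2) * (g / 2 * n) =
            g * (2 * (X + d) ^+ 2 + (kr / 2 + 1) * n) by field.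
  rewrite ler_pM2l//; move: hX hd; generalize ((X + d) ^+ 2) (X ^+ 2) (d ^+ 2) => a b c.
  by move=> ? ?; lra.
rewrite mulrDr lerD//; last by rewrite -[leRHS]mulrA ler_wpM2l// addr_ge0.
rewrite ler_wpM2r//; first by rewrite mulr_ge0// ?sqr_ge0// ltW.
by rewrite -[leLHS]mulr1 ler_pM// lerDr.
Qed.

(** Induction on the number of rows: a nearly shortest primitive vector [a] comes first, the other
    rows are projected orthogonally to [a], and a reduced basis of the projection is lifted back
    with its coefficients along [a] rounded into [-1/2, 1/2]. In the resulting basis a short vector
    has small coordinates. *)
Lemma reduced_basis (R : realType) k D (A : 'M[R]_(k, D)) (mu : R) : 0 < mu ->
  (forall z : 'rV[int]_k, z != 0 -> mu <= sqn (map_mx intr z *m A)) ->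
  exists U : 'M[int]_k, U \in unitmx /\ forall x : 'rV[R]_k,
    mu * sqn x <= (reduction_const k)%:R * sqn (x *m (map_mx intr U *m A)).
Proof.
elim: k A mu => [|k IH] A mu mu0 hmu.
  exists 1%:M; split; first exact: unitmx1.
  by move=> x; rewrite {1}/sqn big_ord0 mulr0 mulr_ge0// sqn_ge0.
have [V [Vu hV]] := short_primitive_row mu0 hmu.
set g := sqn (map_mx intr (row ord0 V) *m A) in hV.
have gmu : mu <= g.
  apply: hmu; rewrite rowE mulmx_unit_neq0//.
  by apply/eqP => /rowP /(_ ord0); rewrite !mxE eqxx.
have g0 : 0 < g by exact: lt_le_trans gmu.
pose VA : 'M[R]_(1 + k, D) := map_mx intr V *m A.
pose a : 'rV[R]_D := usubmx VA.
pose A2 : 'M[R]_(k, D) := dsubmx VA.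
have VAE : map_mx intr V *m A = col_mx a A2 by rewrite [RHS]vsubmxK.
have ga : sqn a = g.
  rewrite /g; congr sqn; rewrite map_row -row_mul; apply/rowP => j.
  by rewrite [LHS]mxE [RHS]mxE; congr ((_ *m _) _ _); exact/val_inj.
clearbody a A2.
pose w : 'cV[R]_k := \col_i (dotr (row i A2) a / g).
pose A' := A2 - w *m a.
have A'a x : dotr (x *m A') a = 0.
  rewrite dotr_mulmx big1// => i _.
  suff -> : dotr (row i A') a = 0 by rewrite mulr0.
  transitivity (dotr (row i A2) a - dotr (row i A2) a / g * sqn a).
    rewrite /dotr /sqn mulr_sumr -sumrB; apply: eq_bigr => j _.
    rewrite !mxE big_ord1 !mxE mulrBl; congr (_ - _).
    by rewrite -!mulrA -expr2.
  by rewrite ga divfK ?subrr// gt_eqF.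
(* The combination is lifted so that its coefficient along [a] is at most 1/2 in absolute value.
   That component accounts for at most g/4 of a squared length that is at least 3g/4, which leaves
   g/2. *)
have hA' z : z != 0 -> g / 2 <= sqn (map_mx intr z *m A').
  move=> z0; set s := (map_mx intr z *m w) ord0 ord0.
  have [n hn] := nearest_int s.
  pose y : 'rV[int]_(1 + k) := row_mx ((- n)%:M : 'M[int]_1) z.
  have y0 : y *m (V : 'M[int]_(1 + k)) != 0.
    apply: mulmx_unit_neq0 => //; apply: contra_neq z0 => y0.
    by move/(congr1 rsubmx): y0; rewrite row_mxKr linear0.
  have := hV _ y0; rewrite map_mxM -mulmxA VAE /y map_row_mx mul_row_col.
  rewrite map_scalar_mx mul_scalar_mx.
  have -> : map_mx intr z *m A2 = s *: a + map_mx intr z *m A'.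
    rewrite mulmxBr mulmxA [_ *m w]mx11_scalar -/s mul_scalar_mx.
    by rewrite addrCA subrr addr0.
  rewrite addrA -scalerDl sqnD_orth//= ga.
  have -> : ((- n)%:~R + s) ^+ 2 = (s - n%:~R) ^+ 2 by rewrite mulrNz addrC.
  nra.
have [U' [U'u hU']] := IH A' (g / 2) (divr_gt0 g0 (ltr0Sn _ _)) hA'.
pose v := map_mx intr U' *m w.
(* [v] holds the coefficients along [a] of the lifted rows; [c] subtracts their nearest integers,
   leaving the remainders [u]. *)
pose c : 'cV[int]_k := \col_i (- sval (cid (nearest_int (v i ord0)))).
pose W : 'M[int]_(1 + k) := block_mx 1%:M 0 c U'.
exists ((W : 'M[int]_k.+1) *m V); split.
  rewrite unitmx_mul Vu andbT unitmxE (_ : \det W = \det U').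
    by rewrite -unitmxE.
  by rewrite /W det_lblock det1 mul1r.
move=> x; set x' : 'rV[R]_k := @rsubmx R 1 1 k x.
pose u : 'rV[R]_k := \row_i (v i ord0 + (c i ord0)%:~R).
have hu i : u ord0 i ^+ 2 <= 1 / 4.
  rewrite mxE [c _ _]mxE mulrNz; exact: (svalP (cid (nearest_int (v i ord0)))).
have uE : x' *m (v + map_mx intr c) = (dotr x' u)%:M.
  rewrite [LHS]mx11_scalar; congr (_%:M); rewrite mxE; apply: eq_bigr => i _.
  by rewrite [(v + _) _ _]mxE [map_mx _ _ _ _]mxE [u _ _]mxE.
have -> : x *m (map_mx intr (W *m (V : 'M[int]_(1 + k))) *m A) =
    (x ord0 ord0 + dotr x' u) *: a + x' *m (map_mx intr U' *m A').
  rewrite map_mxM -mulmxA VAE /W map_block_mx mul_block_col.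
  rewrite map_mx1 map_mx0 mul1mx mul0mx addr0 mulmx_row_col_mx -/x'.
  rewrite scalerDl -addrA; congr (_ + _).
  have -> : map_mx intr U' *m A' = map_mx intr U' *m A2 - v *m a.
    by rewrite mulmxBr mulmxA.
  rewrite -mul_scalar_mx -uE -[x' *m _ *m a]mulmxA -!mulmxDr; congr (x' *m _).
  by rewrite mulmxDl [v *m a + _]addrC addrACA subrr addr0.
rewrite sqnD_orth; last by rewrite mulmxA.
have := hU' x'; set q := sqn (x' *m _) => hq.
have := dotr_sqr_le x' hu; set d := dotr x' u => hd.
rewrite (sqn_row_mx (x : 'rV_(1 + k))) -/x' ga.
have q0 : 0 <= q by exact: sqn_ge0.
have n0 : 0 <= sqn x' by exact: sqn_ge0.
have K1 : 1 <= (reduction_const k)%:R :> R.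
  by rewrite ler1n; elim: (k) => // j IHj /=; rewrite muln_gt0.
have -> : (reduction_const k.+1)%:R = (k%:R + 2) * (reduction_const k)%:R :> R.
  by rewrite /= natrM -addn2 natrD.
exact: reduction_step_le.
Qed.

(** * Lebesgue outer measure and linear maps *)

Definition bvol (R : realType) (D : nat) (a b : 'rV[R]_D) : R :=
  \prod_(i < D) (b ord0 i - a ord0 i).

Definition box_cover (R : realType) (D : nat) (S : set 'rV[R]_D)
    (a b : nat -> 'rV[R]_D) : Prop :=
  (forall k i, a k ord0 i <= b k ord0 i) /\ S `<=` \bigcup_k box (a k) (b k).

Section outer_measure.
Variables (R : realType).
Implicit Type D : nat.
Local Open Scope ereal_scope.

Lemma bvol_ge0 D (a b : 'rV[R]_D) :
  (forall i, (a ord0 i <= b ord0 i)%R) -> (0 <= bvol a b)%R.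
Proof. by move=> ab; apply: prodr_ge0 => i _; rewrite subr_ge0. Qed.

Lemma vol_le_cover D (S : set 'rV[R]_D) a b : box_cover S a b ->
  vol S <= \sum_(0 <= k <oo) (bvol (a k) (b k))%:E.
Proof. by move=> [ab Sab]; apply: ereal_inf_lbound; exists a, b. Qed.

Lemma le_vol_covers D (S : set 'rV[R]_D) x :
  (forall a b, box_cover S a b ->
     x <= \sum_(0 <= k <oo) (bvol (a k) (b k))%:E) ->
  x <= vol S.
Proof.
by move=> h; apply: le_ereal_inf_tmp => _ [a [b [ab Sab ->]]]; exact: h.
Qed.

Lemma vol_ge0 D (S : set 'rV[R]_D) : 0 <= vol S.
Proof.
by apply: le_vol_covers => a b [ab _]; apply: nneseries_ge0 => k _ _; rewrite lee_fin bvol_ge0.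
Qed.

Lemma vol_le D (S S' : set 'rV[R]_D) : S `<=` S' -> vol S <= vol S'.
Proof.
move=> SS'; apply: le_vol_covers => a b [ab S'ab].
by apply: vol_le_cover; split => //; exact: subset_trans S'ab.
Qed.

(** Positive dimension matters: in dimension 0 the empty product gives every box volume 1, so finite
    covers could not be padded by boxes of volume 0. *)
Lemma bvol_const D (a : 'rV[R]_D.+1) : bvol a a = 0%R.
Proof. by rewrite /bvol big_ord_recl subrr mul0r. Qed.

Lemma vol_box_le D (a b : 'rV[R]_D.+1) :
  (forall i, (a ord0 i <= b ord0 i)%R) -> vol (box a b) <= (bvol a b)%:E.
Proof.
move=> ab; apply: (@le_trans _ _ (\sum_(0 <= k <oo)
    (bvol (if k == 0%N then a else b) b)%:E)).
  by apply: (@vol_le_cover _ _ (fun k => if k == 0%N then a else b) (fun=> b)); split;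
    [move=> [|k] i /= | move=> x xab; exists 0%N].
rewrite nneseries_recl//; last by move=> [|k] _; rewrite lee_fin bvol_ge0.
rewrite [X in _ + X]eseries0 ?adde0//.
by move=> [|k]//= _ _; rewrite bvol_const.
Qed.

Lemma vol_set0 D : vol (set0 : set 'rV[R]_D.+1) = 0.
Proof.
apply/eqP; rewrite eq_le vol_ge0 andbT.
apply: (le_trans (@vol_le _ _ (box 0 0) (@sub0set _ _))).
by rewrite (le_trans (@vol_box_le _ _ _ _))// bvol_const.
Qed.

Lemma vol_cover_adherent D (S : set 'rV[R]_D) (e : R) :
  (0 < e)%R -> vol S \is a fin_num ->
  exists ab : (nat -> 'rV[R]_D) * (nat -> 'rV[R]_D), box_cover S ab.1 ab.2 /\
    \sum_(0 <= k <oo) (bvol (ab.1 k) (ab.2 k))%:E <= vol S + e%:E.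
Proof.
move=> e0 Sfin; have [_ [a [b [ab Sab ->]]] h] := lb_ereal_inf_adherent e0 Sfin.
by exists (a, b); split; [split|exact: ltW].
Qed.

(** The n-th set is covered up to an excess of e / 2^(n+1), and a bijection of nat with its square
    merges the covers into a single sequence. *)
Lemma vol_sigma_subadditive D : sigma_subadditive (@vol R D).
Proof.
move=> A; have [[i ioo]|] := pselect (exists i, vol (A i) = +oo).
  rewrite (eseries_pinfty _ _ ioo) ?leey// => n _.
  by rewrite -ltNye (lt_le_trans _ (vol_ge0 _)).
rewrite -forallNE => Aoo.
apply/lee_addgt0Pr => e e0.
rewrite (le_trans _ (epsilon_trick _ _ (ltW e0)))//; last by move=> n; exact: vol_ge0.
have /choice[G PG] : forall n, exists ab : (nat -> 'rV[R]_D) * (nat -> 'rV[R]_D),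
    box_cover (A n) ab.1 ab.2 /\
    \sum_(0 <= k <oo) (bvol (ab.1 k) (ab.2 k))%:E <=
      vol (A n) + (e / (2 ^ n.+1)%:R)%:E.
  move=> n; apply: vol_cover_adherent; first by rewrite divr_gt0// ltr0n expn_gt0.
  by rewrite ge0_fin_numE ?vol_ge0// ltey; apply/eqP.
have /card_esym/ppcard_eqP[f] := card_nat2.
pose a k := (G (f k).1).1 (f k).2; pose b k := (G (f k).1).2 (f k).2.
have abc : box_cover (\bigcup_n A n) a b.
  split=> [k|]; first exact: (PG _).1.1.
  move=> x [n _ /(PG n).1.2 [k _ xab]].
  by exists (f^-1%FUN (n, k)) => //; rewrite /a /b invK ?inE.
apply: (le_trans (vol_le_cover abc)).
pose v (nk : nat * nat) := (bvol ((G nk.1).1 nk.2) ((G nk.1).2 nk.2))%:E.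
have v0 nk : 0 <= v nk by rewrite lee_fin bvol_ge0// => i; exact: (PG _).1.1.
rewrite nneseries_esumT; last by move=> k; exact: (v0 (f k)).
have -> : \esum_(k in [set: nat]) (bvol (a k) (b k))%:E = \esum_(nk in setT) v nk.
  by rewrite (reindex_esum [set: nat] _ f v).
rewrite (_ : setT = setT `*`` (fun _ : nat => [set: nat])); last first.
  by apply/seteqP; split=> -[? ?].
rewrite -(@esum_esum _ _ _ _ _ (fun n k => v (n, k)))//.
rewrite -(@nneseries_esumT _ (fun n => \esum_(k in setT) v (n, k))); last first.
  by move=> n; apply: esum_ge0 => k _; exact: v0.
apply: lee_nneseries => n _; first by move=> _; apply: esum_ge0 => k _; exact: v0.
by rewrite -nneseries_esumT//; exact: (PG n).2.
Qed.
End outer_measure.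

HB.instance Definition _ (R : realType) (D : nat) :=
  isOuterMeasure.Build R _ (@vol R D.+1) (@vol_set0 R D) (@vol_ge0 R D.+1)
    (@vol_le R D.+1) (@vol_sigma_subadditive R D.+1).

Section linear_image.
Variables (R : realType) (D : nat).
Implicit Types (S : set 'rV[R]_D.+1) (A : 'M[R]_D.+1).
Local Open Scope ereal_scope.

Lemma vol_fin_subadditive (I : finType) S (F : I -> set 'rV[R]_D.+1) :
  S `<=` \bigcup_i F i -> vol S <= \sum_(i : I) vol (F i).
Proof.
move=> SF; apply: (@le_trans _ _ (vol (\big[setU/set0]_(i : I) F i))).
  by apply: vol_le => x /SF[i _ Fix]; rewrite -bigcup_seq; exists i => //=; rewrite mem_index_enum.
elim/big_rec2: _ => [|i x A _ Ax].
  by rewrite vol_set0.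
exact: le_trans (outer_measureU2 _ _ _) (leeD2l _ Ax).
Qed.

(** Boxes suffice: a cover of [S] by boxes maps to a cover of its image, and countable subadditivity
    sums the bounds. *)
Lemma vol_linear_of_boxes A (f : R) : (0 < f)%R ->
  (forall a b : 'rV[R]_D.+1, (forall i, (a ord0 i <= b ord0 i)%R) ->
     vol ((mulmx^~ A) @` box a b) <= (f * bvol a b)%:E) ->
  forall S, vol ((mulmx^~ A) @` S) <= f%:E * vol S.
Proof.
move=> f0 hf S; rewrite -lee_pdivrMl//; apply: le_vol_covers => a b [ab Sab].
rewrite lee_pdivrMl// -nneseriesZl; last by move=> k _; rewrite lee_fin bvol_ge0.
apply: (@le_trans _ _ (vol (\bigcup_k (mulmx^~ A @` box (a k) (b k))))).
  by apply: vol_le => _ [x /Sab[k _ xk] <-]; exists k => //; exists x.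
apply: (le_trans (vol_sigma_subadditive _)).
apply: lee_nneseries => k _; first by move=> _; exact: vol_ge0.
by rewrite -EFinM; exact: hf.
Qed.

Lemma vol_perm_mx (s : 'S_D.+1) S :
  vol ((mulmx^~ (perm_mx s)) @` S) <= vol S.
Proof.
rewrite -[leRHS]mul1e; apply: vol_linear_of_boxes => // a b ab.
rewrite mul1r.
pose p (x : 'rV[R]_D.+1) := (\row_i x ord0 ((s^-1)%g i))%R.
rewrite (_ : bvol a b = bvol (p a) (p b)); last first.
  by rewrite /bvol (reindex_inj (@perm.perm_inj _ (s^-1)%g)); apply: eq_bigr => i _; rewrite !mxE.
apply: le_trans (vol_box_le _); last by move=> i; rewrite !mxE.
apply: vol_le => _ [x xab <-] i.
by rewrite -[s in perm_mx s]invgK -col_permE !mxE; exact: xab.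
Qed.

Lemma unit_itv_subdiv (P : nat) (y : R) : (0 < P)%N -> (0 <= y <= 1)%R ->
  exists t : 'I_P, (t%:R <= y * P%:R <= t%:R + 1)%R.
Proof.
move=> P0 /andP[y0 y1].
have yP0 : (0 <= y * P%:R)%R by rewrite mulr_ge0.
have yP : (y * P%:R <= P%:R)%R by rewrite ler_piMl.
have /andP[h1 h2] := truncn_itv yP0.
have [tP|tP] := ltnP (Num.trunc (y * P%:R)) P.
  by exists (Ordinal tP); rewrite /= h1 natr1 ltW.
(* The right end point y = 1 truncates to P and is assigned to the last subinterval. *)
have P1 : (P.-1 < P)%N by rewrite prednK.
exists (Ordinal P1); rewrite /= natr1 prednK// yP andbT (le_trans _ h1)// ler_nat.
exact: leq_trans (leq_pred _) tP.
Qed.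

(* The box is cut into prod_i K^(r i) congruent boxes, the i-th side being cut
   into K^(r i) pieces: the small boxes are so much thinner in the directions
   of high rank that the off-diagonal entries of A only contribute O(1/K) to
   the sides of their images. *)
Lemma vol_triangular_box_subdiv A (r : 'I_D.+1 -> nat) (a b : 'rV[R]_D.+1) (K : nat) :
  (forall i j, i != j -> A i j != 0%R -> (r j < r i)%N) ->
  (forall i, (a ord0 i < b ord0 i)%R) -> (0 < K)%N ->
  vol ((mulmx^~ A) @` box a b) <=
  (\prod_j ((b ord0 j - a ord0 j) * (`|A j j| +
     (1 + \sum_i `|A i j| * (b ord0 i - a ord0 i) / (b ord0 j - a ord0 j)) / K%:R)))%:E.
Proof.
move=> rA ab K0.
have KR0 : (0 < K%:R :> R)%R by rewrite ltr0n.
pose h i : R := (b ord0 i - a ord0 i)%R.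
have h0 i : (0 < h i)%R by rewrite subr_gt0.
pose w i : R := (h i / (K ^ r i)%:R)%R.
have Kr0 i : (0 < (K ^ r i)%:R :> R)%R by rewrite ltr0n expn_gt0 K0.
have w0 i : (0 < w i)%R by rewrite divr_gt0.
(* The summand 1 makes [hom] strict, so that the image of a closed small box still fits into a box
   that is open on one side. *)
pose C j : R := (1 + \sum_i `|A i j| * h i / h j)%R.
pose om j : R := (w j * (`|A j j| + C j / K%:R))%R.
(* [p] is the centre of the small box with index [t], and [F t] is the box with sides [om] about the
   image of [p]. *)
pose F (t : {dffun forall i, 'I_(K ^ r i)}) : set 'rV[R]_D.+1 :=
  let p : 'rV[R]_D.+1 := (\row_i (a ord0 i + ((t i)%:R + 1 / 2) * w i))%R in
  box (\row_j ((p *m A) ord0 j - om j / 2))%R (\row_j ((p *m A) ord0 j + om j / 2))%R.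
have om0 j : (0 <= om j)%R.
  rewrite mulr_ge0 ?(ltW (w0 _))// addr_ge0// divr_ge0 ?(ltW KR0)//.
  by rewrite addr_ge0// sumr_ge0// => i _; rewrite divr_ge0 ?mulr_ge0// ltW.
have hom j : (\sum_i w i * `|A i j| < om j)%R.
  rewrite (bigD1 j)//= /om mulrDr ltrD2l.
  apply: (@le_lt_trans _ _ (\sum_i w j * (`|A i j| * h i / h j / K%:R))%R).
    rewrite [leRHS](bigD1 j)//= ler_wpDl//.
      by rewrite mulr_ge0 ?(ltW (w0 _))// !divr_ge0 ?mulr_ge0 ?(ltW (h0 _))// ltW.
    (* For a nonzero off-diagonal entry, r j < r i makes w i at most h i / K^(r j + 1), which is w j
       (h i / h j) / K. *)
    apply: ler_sum => i ij; have [->|Aij] := eqVneq (A i j) 0%R.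
      by rewrite normr0 !mul0r !mulr0.
    have := rA _ _ ij Aij => rji.
    have -> : (w j * (`|A i j| * h i / h j / K%:R) =
       h i / (K ^ (r j).+1)%:R * `|A i j|)%R.
      rewrite /w expnS natrM; field.
      by rewrite !gt_eqF.
    rewrite ler_wpM2r// ler_wpM2l ?(ltW (h0 _))// lef_pV2 ?posrE// ?ltr0n ?expn_gt0 ?K0//.
    by rewrite ler_nat leq_pexp2l.
  rewrite -mulr_sumr ltr_pM2l// -mulr_suml ltr_pM2r ?invr_gt0//.
  by rewrite /C ltrDr.
have cover : (mulmx^~ A) @` box a b `<=` \bigcup_t F t.
  move=> _ [x xab <-].
  have : forall i, exists t : 'I_(K ^ r i),
      (`|x ord0 i - (a ord0 i + (t%:R + 1 / 2) * w i)| <= w i / 2)%R.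
    move=> i; have /andP[xa xb] := xab i.
    have y01 : (0 <= (x ord0 i - a ord0 i) / h i <= 1)%R.
      apply/andP; split; first by apply: divr_ge0; rewrite ?subr_ge0; exact: ltW.
      by rewrite ler_pdivrMr// mul1r lerD2r.
    have Kr : (0 < K ^ r i)%N by rewrite expn_gt0 K0.
    have [t] := unit_itv_subdiv Kr y01.
    have -> : ((x ord0 i - a ord0 i) / h i * (K ^ r i)%:R =
               (x ord0 i - a ord0 i) / w i)%R.
      by rewrite /w; field; rewrite !gt_eqF.
    rewrite ler_pdivrMr// ler_pdivlMr// => /andP[t1 t2]; exists t.
    rewrite ler_norml; move: t1 t2; move: (w i) (t%:R : R)%R (x ord0 i) (a ord0 i) => u v y z.
    by clear=> *; apply/andP; split; lra.
  move=> /(@fin_all_exists _ (fun i => 'I_(K ^ r i)))[t ht].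
  exists [ffun i => t i] => // j; rewrite !mxE.
  set p := (\row_i _)%R; set s := (\sum_i _)%R; set s' := (\sum_i _)%R.
  suff : (`|s' - s| < om j / 2)%R.
    rewrite ltr_distl => /andP[? ?]; apply/andP; split => //; exact: ltW.
  rewrite /s /s' -sumrB (le_lt_trans (ler_norm_sum _ _ _))//.
  apply: (@le_lt_trans _ _ (\sum_i w i * `|A i j| / 2)%R); last first.
    by rewrite -mulr_suml ltr_pM2r ?invr_gt0.
  apply: ler_sum => i _; rewrite -mulrBl normrM mulrAC ler_wpM2r//.
  by rewrite mxE ffunE.
apply: (le_trans (vol_fin_subadditive cover)).
apply: (@le_trans _ _ (\sum_(t : {dffun forall i, 'I_(K ^ r i)}) (\prod_j om j)%:E)).
  apply: lee_sum => t _; apply: (le_trans (vol_box_le _)).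
    by move=> i; rewrite !mxE lerD2l -subr_ge0 opprK -splitr.
  rewrite lee_fin le_eqVlt; apply/orP; left; apply/eqP; apply: eq_bigr => j _.
  by rewrite !mxE; move: (om j) => u; field.
rewrite sumEFin lee_fin sumr_const card_dep_ffun.
have -> : foldr muln 1%N [seq #|'I_(K ^ r x)| | x : 'I_D.+1] = (\prod_i K ^ r i)%N.
  by rewrite foldrE big_image/=; apply: eq_bigr => i _; rewrite card_ord.
rewrite -[(_ *+ _)%R](mulr_natl (\prod_j om j)) natr_prod -big_split/=.
rewrite le_eqVlt; apply/orP; left; apply/eqP.
apply: eq_bigr => j _; rewrite /om /w mulrA mulrCA mulfV ?mulr1//.
by rewrite gt_eqF.
Qed.

(** The subdivision bound is passed to the limit in K. A box with a side of length 0 is empty, being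
    half-open. *)
Lemma vol_triangular_box A (r : 'I_D.+1 -> nat) (a b : 'rV[R]_D.+1) :
  (forall i j, i != j -> A i j != 0%R -> (r j < r i)%N) ->
  (forall i, (a ord0 i <= b ord0 i)%R) ->
  vol ((mulmx^~ A) @` box a b) <= (\prod_j `|A j j| * bvol a b)%:E.
Proof.
move=> rA ab.
have [/forallP ab'|] := boolP [forall i, (a ord0 i < b ord0 i)%R]; last first.
  move=> /forallPn[i abi]; rewrite (_ : _ @` _ = set0) ?vol_set0; last first.
    apply/seteqP; split=> // y [x /(_ i)/andP[xa xb] _].
    by move/negP: abi; apply; exact: lt_le_trans xb.
  by rewrite lee_fin mulr_ge0 ?bvol_ge0// prodr_ge0.
have vfin : vol ((mulmx^~ A) @` box a b) \is a fin_num.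
  rewrite ge0_fin_numE ?vol_ge0//.
  by apply: le_lt_trans (vol_triangular_box_subdiv rA ab' (ltn0Sn 0)) _; rewrite ltry.
rewrite -(fineK vfin) lee_fin.
pose u (K : nat) : R := (\prod_j ((b ord0 j - a ord0 j) * (`|A j j| +
     (1 + \sum_i `|A i j| * (b ord0 i - a ord0 i) / (b ord0 j - a ord0 j)) / K.+1%:R)))%R.
have cu : u K @[K --> \oo] --> (\prod_j `|A j j| * bvol a b)%R.
  rewrite /bvol -big_split/=; apply: cvg_big => [|j _]; first exact: mul_continuous.
  rewrite mulrC; apply: cvgMr; rewrite -[X in _ --> X]addr0.
  apply: cvgD; first exact: cvg_cst.
  rewrite -[X in _ --> X](mulr0 (1 + \sum_i `|A i j| * (b ord0 i - a ord0 i) / (b ord0 j - a ord0 j))%R).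
  by apply: cvgMr; exact: cvg_harmonic.
apply: (cvgr_to_ge cu); near=> K.
rewrite -lee_fin fineK//; exact: (vol_triangular_box_subdiv rA ab' (ltn0Sn K)).
Unshelve. all: by end_near. Qed.

(** The rank function [r] covers both shapes: the row index itself suits lower triangular matrices,
    the reversed index upper triangular ones. *)
Lemma vol_triangular A (r : 'I_D.+1 -> nat) S :
  (forall i j, i != j -> A i j != 0%R -> (r j < r i)%N) ->
  (0 < \prod_j `|A j j|)%R ->
  vol ((mulmx^~ A) @` S) <= (\prod_j `|A j j|)%:E * vol S.
Proof.
by move=> rA A0; apply: vol_linear_of_boxes => // a b ab; exact: vol_triangular_box rA ab.
Qed.

(** LUP decomposition: a permutation does not increase volume, the unipotent factor [L] contributes
    the factor 1, and the diagonal of [U] gives the absolute value of the determinant. *)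
Lemma vol_linear_le A S : A \in unitmx ->
  vol ((mulmx^~ A) @` S) <= `|\det A|%:E * vol S.
Proof.
move=> Au; have := cormen_lup_correct A; have := cormen_lup_perm A.
have := cormen_lup_detL A; have := @cormen_lup_upper _ _ A.
have := @cormen_lup_lower _ _ A.
case: (cormen_lup A) => [[P L] U]/= hL hU detL /is_perm_mxP[s ->{P}] sA.
have {}sA : perm_mx s *m A = L *m U := sA.
have AE : A = perm_mx s^-1 *m (L *m U).
  by rewrite -sA mulmxA -perm_mxM mulVg perm_mx1 mul1mx.
have LD : (\prod_j `|L j j| = 1)%R by rewrite big1// => j _; rewrite hL// eqxx normr1.
have detU : `|\det U|%R = (\prod_j `|U j j|)%R.
  rewrite -det_tr det_trig ?normr_prod; first by apply: eq_bigr => j _; rewrite mxE.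
  by apply/is_trig_mxP => i j ij; rewrite mxE hU.
have detA : `|\det A|%R = (\prod_j `|U j j|)%R.
  by rewrite AE !det_mulmx detL mul1r det_perm normrM normr_sign mul1r.
rewrite detA (_ : mulmx^~ A = (mulmx^~ U) \o (mulmx^~ L) \o (mulmx^~ (perm_mx s^-1))); last first.
  by apply/funext => x /=; rewrite AE !mulmxA.
rewrite -(image_comp (mulmx^~ (perm_mx s^-1))) -(image_comp (mulmx^~ L)).
apply: (le_trans (@vol_triangular U (fun i => D - i)%N _ _ _)).
- move=> i j ij Uij; have [ji|] := ltnP j i; first by rewrite hU ?eqxx in Uij.
  rewrite leq_eqVlt => /predU1P[/val_inj ij'|ij']; first by rewrite ij' eqxx in ij.
  by rewrite ltn_sub2l// (leq_trans ij')// -ltnS ltn_ord.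
- by rewrite -detA normr_gt0 -unitfE -unitmxE.
rewrite lee_wpmul2l ?lee_fin -?detA//.
apply: (le_trans (@vol_triangular L val _ _ _)); rewrite ?LD ?mul1e//.
  move=> i j ij Lij; rewrite ltnNge; apply/negP => ij'.
  by rewrite hL// (negbTE ij) eqxx in Lij.
exact: vol_perm_mx.
Qed.

(** The reverse inequality is [vol_linear_le] for the inverse matrix, applied to the image of
    [S]. *)
Lemma vol_linear A S : A \in unitmx ->
  vol ((mulmx^~ A) @` S) = `|\det A|%:E * vol S.
Proof.
move=> Au; apply/eqP; rewrite eq_le vol_linear_le//=.
have dA : (0 < `|\det A|)%R by rewrite normr_gt0 -unitfE -unitmxE.
rewrite -lee_pdivlMl//.
have Au' : invmx A \in unitmx by rewrite unitmx_inv.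
have := @vol_linear_le (invmx A) ((mulmx^~ A) @` S) Au'.
rewrite det_inv normfV image_comp (_ : _ \o _ = id) ?image_id//.
by apply/funext => x /=; rewrite mulmxK.
Qed.

End linear_image.

(** * Unit cells *)

(** Half-open like [box], so that the cells partition the space; each contains its integer point [z]
    as upper corner. *)
Definition cell (R : realType) (D : nat) (z : 'rV[int]_D) : set 'rV[R]_D :=
  [set x | forall i, (z ord0 i)%:~R - 1 < x ord0 i <= (z ord0 i)%:~R].

(* Induction on the dimension, integrating over the first coordinate. *)
Lemma cells_le_cover (R : realType) D (P : pred nat) (a b : nat -> 'rV[R]_D)
    (F : seq 'rV[int]_D) :
  uniq F -> (forall k, P k -> forall i, a k ord0 i <= b k ord0 i) ->
  (forall z, z \in F -> forall x, cell z x -> exists2 k, P k & box (a k) (b k) x) ->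
  ((size F)%:R%:E <= \sum_(0 <= k <oo | P k) (bvol (a k) (b k))%:E)%E.
Proof.
elim: D P a b F => [|D IH] P a b F uF ab cov.
  have [->|[z zF]] : F = [::] \/ exists z, z \in F.
    by case: (F) => [|z s]; [left|right; exists z; rewrite mem_head].
    by apply: nneseries_ge0 => k _ Pk; rewrite lee_fin bvol_ge0//; exact: ab.
  have [|k Pk _] := cov _ zF 0; first by move=> [].
  (* Dimension 0 has only one integer vector, and a single selected box, of volume 1 as an empty
     product, is enough. *)
  have FE : (size F <= 1)%N.
    rewrite -[1%N]/(size [:: z]); apply: uniq_leq_size => // z' _.
    by rewrite inE; apply/eqP/rowP => -[].
  apply: (@le_trans _ _ 1%E); first by rewrite lee_fin lern1.
  have -> : 1%E = (bvol (a k) (b k))%:E by rewrite /bvol big_ord0.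
  apply: (le_trans _ (nneseries_lim_ge k.+1 _)) => [|i _ Pi]; last first.
    by rewrite lee_fin bvol_ge0//; exact: ab.
  rewrite big_mkcond big_nat_recr//= Pk leeDr// sume_ge0// => i _.
  by case: ifP => // Pi; rewrite lee_fin bvol_ge0//; exact: ab.
pose mu := @lebesgue_measure R.
have muE (x y : R) : x <= y -> mu `]x, y]%classic = (y - x)%:E.
  rewrite /mu lebesgue_measure_itv/= lte_fin le_eqVlt -EFinB => /predU1P[->|->//].
  by rewrite ltxx subrr.
pose tl (T : Type) (x : 'rV[T]_D.+1) : 'rV[T]_D := \row_i x ord0 (lift ord0 i).
pose v k : R := bvol (tl R (a k)) (tl R (b k)).
have v0 k : P k -> 0 <= v k.
  by move=> Pk; apply: bvol_ge0 => i; rewrite !mxE; exact: ab.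
pose J k : set (measurableTypeR R) := `]a k ord0 ord0, b k ord0 ord0]%classic.
pose JZ (z : 'rV[int]_D.+1) : set (measurableTypeR R) :=
  `](z ord0 ord0)%:~R - 1, (z ord0 ord0)%:~R]%classic.
pose f k (x : measurableTypeR R) : \bar R := ((if P k then v k else 0%R)%:E * (\1_(J k) x)%:E)%E.
have f0 k x : (0 <= f k x)%E.
  by rewrite mule_ge0// lee_fin//; case: ifP => // /v0.
pose g (x : measurableTypeR R) : \bar R := (\sum_(z <- F) (\1_(JZ z) x)%:E)%E.
have mJ k : measurable (J k) by exact: measurable_itv.
have mJZ z : measurable (JZ z) by exact: measurable_itv.
have mindic (A : set (measurableTypeR R)) :
    measurable A -> measurable_fun setT (fun x => (\1_A x : R)%:E).
  by move=> mA; apply/measurable_EFinP; exact: measurable_indic.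
have mf k : measurable_fun setT (f k).
  by apply: emeasurable_funM; [exact: measurable_cst|exact: mindic].
have -> : (\sum_(0 <= k <oo | P k) (bvol (a k) (b k))%:E =
    \int[mu]_x (\sum_(0 <= k <oo) f k x))%E.
  rewrite integral_nneseries// eseries_mkcond; apply: eq_eseriesr => k _.
  rewrite ge0_integralZl//; last 2 first.
  - exact: mindic.
  - by rewrite lee_fin; case: ifP => // /v0.
  rewrite integral_indic// setIT; case: ifPn => [Pk|_]; last by rewrite mul0e.
  rewrite [X in (_ * X)%E]muE ?ab// -EFinM /bvol big_ord_recl mulrC.
  by congr (_ * _)%:E; apply: eq_bigr => i _; rewrite !mxE.
have -> : (size F)%:R%:E = (\int[mu]_x g x)%E.
  rewrite /g ge0_integral_sum//; last by move=> z; exact: mindic.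
  transitivity (\sum_(z <- F) 1%E : \bar R)%E.
    by rewrite sumEFin big_const_seq count_predT iter_addr_0.
  apply: eq_bigr => z _; rewrite integral_indic// setIT [RHS]muE ?gerBl//.
  by rewrite opprB addrC subrK.
apply: ge0_le_integral => //.
- by move=> x _; apply: sume_ge0 => z _; rewrite lee_fin.
- by apply: emeasurable_sum => z; exact: mindic.
- by apply: ge0_emeasurable_sum.
(* On the slice with first coordinate [x], [g] counts the cells meeting the slice and the series
   adds up the volumes of the slices of the boxes. The comparison is the induction hypothesis for
   the remaining coordinates, restricted to the boxes that meet the slice; this restriction is the
   reason for the predicate [P]. *)
move=> x _.
have -> : g x = (size [seq tl int z | z <- [seq z <- F | x \in JZ z]])%:R%:E.
  rewrite size_map size_filter /g sumEFin -sum1_count natr_sum.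
  rewrite [in RHS]big_mkcond/=.
  by congr (_%:E); apply: eq_bigr => z _; rewrite indicE; case: (_ \in _).
have -> : (\sum_(0 <= k <oo) f k x =
    \sum_(0 <= k <oo | P k && (x \in J k)) (v k)%:E)%E.
  rewrite [RHS]eseries_mkcond; apply: eq_eseriesr => k _.
  rewrite /f indicE; case: (P k) => /=; last by rewrite mul0e.
  by case: (_ \in _); rewrite ?mule1 ?mule0.
have JZx z : x \in JZ z -> z ord0 ord0 = Num.ceil x.
  by rewrite inE /JZ/= in_itv/= => /andP[h1 h2]; apply/esym/ceil_def; rewrite intrB h1.
apply: IH => [|k /andP[Pk _] i|y /mapP[z]].
(* All cells meeting the slice have first coordinate [Num.ceil x], so distinct cells keep distinct
   tails. *)
- rewrite map_inj_in_uniq ?filter_uniq// => z z'.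
  rewrite !mem_filter => /andP[/JZx zx _] /andP[/JZx zx' _] zz'.
  apply/rowP => i; case: (unliftP ord0 i) => [j ->|->]; last by rewrite zx zx'.
  by move/rowP: zz' => /(_ j); rewrite !mxE.
- by rewrite !mxE; exact: ab.
- rewrite mem_filter => /andP[zx zF] -> y' hy'.
  pose w : 'rV[R]_D.+1 := \row_i (if unlift ord0 i is Some j then y' ord0 j else x).
  have w0 : w ord0 ord0 = x by rewrite mxE unlift_none.
  have wl j : w ord0 (lift ord0 j) = y' ord0 j by rewrite mxE liftK.
  have [|k Pk wk] := cov _ zF w.
    move=> i; case: (unliftP ord0 i) => [j ->|->].
      by rewrite wl; have := hy' j; rewrite !mxE.
    by rewrite w0; move: zx; rewrite inE /JZ/= in_itv.
  exists k; first by rewrite Pk inE /J/= in_itv/=; have := wk ord0; rewrite w0.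
  by move=> i; rewrite !mxE -wl; exact: wk.
Qed.

(** * Cells meeting the boundary, and integer points against volume *)

(** If the segment avoided the boundary, the parameters with a point in [S] would form a nonempty
    subset of [0, 1], both open and closed in it, hence all of [0, 1]. *)
Lemma segment_meets_boundary (R : realType) D (S : set 'rV[R]_D) (x y : 'rV[R]_D) :
  S x -> ~ S y ->
  exists2 t : R, 0 <= t <= 1 & boundary S (x + t *: (y - x)).
Proof.
move=> Sx Sy; pose f (t : R) : 'rV[R]_D := x + t *: (y - x).
apply: contrapT => nb.
have nbd t : 0 <= t <= 1 -> closure S (f t) -> interior S (f t).
  by move=> t01 ct; apply: contrapT => it; apply: nb; exists t.
have cf : continuous f.
  move=> t; apply: cvgD; first exact: cvg_cst.
  by apply: cvgZ; [exact: cvg_id|exact: cvg_cst].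
have S01 : `[0, 1]%classic `&` f @^-1` S = `[0, 1]%classic.
  apply: (@segment_connected R 0 1).
  - by exists 0; split; rewrite /= ?in_itv/= ?lexx ?ler01// /f scale0r addr0.
  - exists (f @^-1` interior S).
      by apply: open_comp => [t _|]; [exact: cf|exact: open_interior].
    apply/seteqP; split => t [t01 ft]; split => //; last exact: interior_subset ft.
    by apply: nbd; [move: t01; rewrite /= in_itv|exact: (@subset_closure _ S) ft].
  - exists (f @^-1` closure S).
      by apply: closed_comp => [t _|]; [exact: cf|exact: closed_closure].
    apply/seteqP; split => t [t01 ft]; split => //; first exact: (@subset_closure _ S) ft.
    by move: t01; rewrite /= in_itv => t01; exact: (interior_subset (nbd _ t01 ft)).
have : (`[0, 1]%classic `&` f @^-1` S) 1 by rewrite S01 /= in_itv/= lexx ler01.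
by move=> [_]; rewrite /f /= scale1r addrC subrK.
Qed.

Lemma cell_ceil (R : realType) D (z : 'rV[int]_D) (x : 'rV[R]_D) :
  cell z x <-> forall i, z ord0 i = Num.ceil (x ord0 i).
Proof.
split=> zx i.
  by have := zx i => /andP[h1 h2]; apply/esym/ceil_def; rewrite intrB h1.
by have := ceil_itv (x ord0 i); rewrite -zx intrB.
Qed.

(** Cells are convex, so the boundary point on the segment from [x] to [y] stays in the cell. *)
Lemma cell_meets_boundary (R : realType) D (S : set 'rV[R]_D) (z : 'rV[int]_D)
    (x y : 'rV[R]_D) :
  cell z x -> cell z y -> S x -> ~ S y -> exists2 p, cell z p & boundary S p.
Proof.
move=> zx zy Sx Sy; have [t /andP[t0 t1] bt] := segment_meets_boundary Sx Sy.
exists (x + t *: (y - x)) => // i; have := zx i; have := zy i; rewrite !mxE.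
move: (x ord0 i) (y ord0 i) (_%:~R) => u v w /andP[h1 h2] /andP[h3 h4].
have -> : u + t * (v - u) = (1 - t) * u + t * v by ring.
have s0 : 0 <= 1 - t by rewrite subr_ge0.
clear -h1 h2 h3 h4 t0 t1 s0.
apply/andP; split; last by nra.
have [->|t_neq1] := eqVneq t 1; first by rewrite subrr mul0r add0r mul1r.
have s1 : 0 < 1 - t by rewrite subr_gt0 lt_neqAle t_neq1.
by nra.
Qed.

Lemma enormE (R : realType) D (x : 'rV[R]_D) : enorm x = Num.sqrt (sqn x).
Proof. by []. Qed.

Lemma enorm_ge0 (R : realType) D (x : 'rV[R]_D) : 0 <= enorm x.
Proof. exact: sqrtr_ge0. Qed.

Lemma sqr_enorm (R : realType) D (x : 'rV[R]_D) : enorm x ^+ 2 = sqn x.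
Proof. by rewrite sqr_sqrtr// sqn_ge0. Qed.

Lemma coord_le_enorm (R : realType) D (x : 'rV[R]_D) i : `|x ord0 i| <= enorm x.
Proof.
rewrite -(@ler_pXn2r _ 2)// ?nnegrE ?enorm_ge0//.
by rewrite sqr_enorm real_normK ?num_real// sqr_le_sqn.
Qed.

Lemma enorm_le_card (R : realType) D (x : 'rV[R]_D) (e : R) : 0 <= e ->
  (forall i, `|x ord0 i| <= e) -> enorm x <= D%:R * e.
Proof.
move=> e0 xe; rewrite -(@ler_pXn2r _ 2)// ?nnegrE ?enorm_ge0// ?mulr_ge0//.
rewrite sqr_enorm; apply: (@le_trans _ _ (\sum_(i < D) e ^+ 2)).
  by apply: ler_sum => i _; rewrite -(@real_normK _ (x _ _)) ?num_real// ler_pXn2r ?nnegrE.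
rewrite sumr_const card_ord -[leLHS]mulr_natl exprMn ler_wpM2r ?sqr_ge0// -natrX ler_nat.
by case: D {x xe} => // D; rewrite leq_pmulr.
Qed.

(** The parameter cube is cut into q^d subcubes with q > L. Each point of a subcube is within d/q of
    its corner, so its image is within d of the image of the corner, and the upper corner of its
    cell differs by at most d in every coordinate. This leaves 2d + 1 integers for each of the d + 1
    coordinates. *)
Lemma Lip_cells (R : realType) d M (L : R) (B : set 'rV[R]_d.+1) :
  0 <= L -> Lip M L B ->
  exists (T : finType) (c : T -> 'rV[int]_d.+1),
    #|T| = (M * (Num.trunc L).+1 ^ d * (2 * d).+1 ^ d.+1)%N /\
    forall z p, cell z p -> B p -> exists t, z = c t.
Proof.
move=> L0 [phi [lip cov]]; set q := (Num.trunc L).+1.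
have qR0 : (0 < q%:R :> R) by rewrite ltr0n.
have Lq : L <= q%:R by have /andP[_ /ltW] := truncn_itv L0.
pose pt (t : {ffun 'I_d -> 'I_q}) : 'rV[R]_d := \row_i ((t i)%:R / q%:R).
exists ('I_M * {ffun 'I_d -> 'I_q} * {ffun 'I_d.+1 -> 'I_(2 * d).+1})%type.
exists (fun t : 'I_M * {ffun 'I_d -> 'I_q} * {ffun 'I_d.+1 -> 'I_(2 * d).+1} =>
  \row_j (Num.ceil (phi t.1.1 (pt t.1.2) ord0 j) - d%:Z + (t.2 j)%:Z)).
split; first by rewrite !card_prod !card_ffun !card_ord.
move=> z p zp /cov[k _ [x xc xp]].
have [t ht] : exists t : {ffun 'I_d -> 'I_q}, forall i, `|x ord0 i - pt t ord0 i| <= q%:R^-1.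
  have /fin_all_exists[t ht] : forall i, exists t : 'I_q, t%:R <= x ord0 i * q%:R <= t%:R + 1.
    by move=> i; apply: unit_itv_subdiv => //; exact: xc.
  exists [ffun i => t i] => i; rewrite mxE ffunE; have /andP[h1 h2] := ht i.
  rewrite ler_norml !lerBrDr !lerBlDr.
  have -> : - q%:R^-1 + (t i)%:R / q%:R = ((t i)%:R - 1) / q%:R :> R.
    by rewrite mulrBl mul1r addrC.
  have -> : q%:R^-1 + (t i)%:R / q%:R = ((t i)%:R + 1) / q%:R :> R.
    by rewrite mulrDl mul1r addrC.
  by rewrite ler_pdivrMr// ler_pdivlMr// h2 andbT (le_trans _ h1)// gerBl.
have ptc : unit_cube (pt t).
  move=> i; rewrite mxE divr_ge0//= ler_pdivrMr// mul1r ler_nat.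
  by rewrite ltnW// ltn_ord.
have close j : `|p ord0 j - phi k (pt t) ord0 j| <= d%:R.
  have := coord_le_enorm (p - phi k (pt t)) j; rewrite !mxE => /le_trans; apply.
  rewrite -xp (le_trans (lip _ _ _ xc ptc))//.
  apply: (@le_trans _ _ (q%:R * (d%:R / q%:R))); last by rewrite mulrC divfK// gt_eqF.
  apply: ler_pM => //; first exact: enorm_ge0.
  by apply: enorm_le_card => [|i]; rewrite ?invr_ge0 ?(ltW qR0)// !mxE; have := ht i; rewrite mxE.
have zj j : exists o : 'I_(2 * d).+1,
    z ord0 j = Num.ceil (phi k (pt t) ord0 j) - d%:Z + o%:Z.
  have -> : z ord0 j = Num.ceil (p ord0 j) by exact: (cell_ceil z p).1.
  have := close j; rewrite ler_distl => /andP[h1 h2].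
  set u := phi k _ _ _ in h1 h2 *; set v := p _ _ in h1 h2 *.
  have c1 : Num.ceil v <= Num.ceil u + d%:Z.
    rewrite ceil_le_int intrD (le_trans h2)// lerD2r.
    exact: ceil_ge.
  have c2 : Num.ceil u <= Num.ceil v + d%:Z.
    rewrite ceil_le_int intrD.
    by apply: (@le_trans _ _ (v + d%:R)); [rewrite -lerBlDr|rewrite lerD2r ceil_ge].
  have o0 : 0 <= Num.ceil v - Num.ceil u + d%:Z by lia.
  have om : (absz (Num.ceil v - Num.ceil u + d%:Z)%R < (2 * d).+1)%N by lia.
  by exists (Ordinal om) => /=; lia.
have /fin_all_exists[off ho] := zj.
by exists (k, t, [ffun j => off j]); apply/rowP => j; rewrite !mxE /= ffunE.
Qed.

Lemma vol_cell (R : realType) d (z : 'rV[int]_d.+1) :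
  (vol (cell z : set 'rV[R]_d.+1) <= 1)%E.
Proof.
pose a : 'rV[R]_d.+1 := \row_i ((z ord0 i)%:~R - 1).
pose b : 'rV[R]_d.+1 := \row_i (z ord0 i)%:~R.
have -> : cell z = box a b by apply/seteqP; split=> x xz i; have := xz i; rewrite !mxE.
apply: (le_trans (vol_box_le _)) => [i|]; first by rewrite !mxE gerBl.
by rewrite lee_fin /bvol big1// => i _; rewrite !mxE opprB addrC subrK.
Qed.

Lemma finite_cells (R : realType) D (r : R) :
  finite_set [set z : 'rV[int]_D | exists2 x : 'rV[R]_D, cell z x & forall i, `|x ord0 i| <= r].
Proof.
pose k := `|Num.ceil r|%N.
pose c (t : {ffun 'I_D -> 'I_(2 * k).+2}) : 'rV[int]_D := \row_i ((t i)%:Z - k%:Z).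
apply: (@sub_finite_set _ _ (c @` setT)); last exact/finite_image/finite_finset.
move=> z [x /cell_ceil zx xr].
have /fin_all_exists[t ht] : forall i, exists t : 'I_(2 * k).+2, z ord0 i = t%:Z - k%:Z.
  move=> i; have := xr i; rewrite ler_norml => /andP[h1 h2].
  have zr : z ord0 i <= Num.ceil r by rewrite zx le_ceil.
  have zr' : - Num.ceil r <= z ord0 i.
    rewrite -(ler_int R) intrN (le_trans _ (le_trans h1 _))//.
      by rewrite lerN2 ceil_ge.
    by rewrite zx ceil_ge.
  have ok : (absz (z ord0 i + k%:Z)%R < (2 * k).+2)%N by lia.
  by exists (Ordinal ok) => /=; lia.
by exists [ffun i => t i] => //; apply/rowP => i; rewrite mxE ffunE ht.
Qed.

Lemma int_points_vol_le (R : realType) d M (L r : R) (S : set 'rV[R]_d.+1) :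
  (forall x, S x -> forall i, `|x ord0 i| <= r) ->
  0 <= L -> Lip M L (boundary S) ->
  exists s : seq 'rV[int]_d.+1, [/\ uniq s, forall z, z \in s <-> S (map_mx intr z) &
    exists2 v : R, vol S = v%:E &
    `|(size s)%:R - v| <= (M * (Num.trunc L).+1 ^ d * (2 * d).+1 ^ d.+1)%:R].
Proof.
move=> Sr L0 lip; have [T [c [cardT hc]]] := Lip_cells L0 lip.
have /finite_seqP[s0 s0E] := @finite_cells R d.+1 r.
pose meets z := `[< exists2 x, cell z x & S x >].
pose inside z := `[< @cell R _ z `<=` S >].
pose s := [seq z <- undup s0 | meets z].
have us : uniq s by rewrite filter_uniq// undup_uniq.
have ms z : (z \in s) = meets z.
  rewrite mem_filter mem_undup andb_idr// => /asboolP[x zx Sx].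
  have : [set z | exists2 x : 'rV[R]_d.+1, cell z x & forall i, `|x ord0 i| <= r] z.
    by exists x => //; exact: Sr.
  by rewrite s0E.
have cellz z : @cell R _ z (map_mx intr z) by move=> i; rewrite mxE lexx gtrBl ltr01.
pose sZ := [seq z <- s | `[< S (map_mx intr z) >]].
exists sZ; split; first by rewrite filter_uniq.
  move=> z; rewrite mem_filter ms; split=> [/andP[/asboolP]//|Sz].
  by apply/andP; split; apply/asboolP => //; exists (map_mx intr z).
have count_inside : (count inside s <= size sZ <= size s)%N.
  rewrite size_filter count_size andbT; apply: sub_count => z /asboolP zS.
  by apply/asboolP; exact: zS.
(* A cell that meets [S] without lying in it contains points of [S] and of its complement, hence a
   boundary point, and so is among the values of [c]. *)
have diff : (size s - count inside s <= #|T|)%N.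
  rewrite -(count_predC inside s) addKn -size_filter.
  rewrite -[#|T|](size_codom c); apply: uniq_leq_size; first by rewrite filter_uniq.
  move=> z; rewrite mem_filter ms => /andP[/asboolPn zS /asboolP[x zx Sx]].
  have [y zy Sy] : exists2 y, cell z y & ~ S y.
    by apply: contrapT => ny; apply: zS => y zy; apply: contrapT => Sy; apply: ny; exists y.
  have [p zp bp] := cell_meets_boundary zx zy Sx Sy.
  by have [t ->] := hc _ _ zp bp; exact: codom_f.
have vol_up : (vol S <= (size s)%:R%:E)%E.
  have cov : S `<=` \bigcup_(i : 'I_(size s)) cell (nth 0 s i).
    move=> x Sx; pose z : 'rV[int]_d.+1 := \row_i Num.ceil (x ord0 i).
    have zx : cell z x by apply/cell_ceil => i; rewrite mxE.
    have zs : z \in s by rewrite ms; apply/asboolP; exists x.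
    have iz : (index z s < size s)%N by rewrite index_mem.
    by exists (Ordinal iz) => //=; rewrite nth_index.
  apply: (le_trans (vol_fin_subadditive cov)).
  apply: (@le_trans _ _ (\sum_(i < size s) 1%E : \bar R)%E).
    by apply: lee_sum => i _; exact: vol_cell.
  by rewrite sumEFin lee_fin sumr_const card_ord.
(* For an outer measure the lower bound must hold for every cover of [S], and such a cover also
   covers the cells inside [S]. *)
have vol_lo : ((count inside s)%:R%:E <= vol S)%E.
  apply: le_vol_covers => a b [ab cov]; rewrite -size_filter.
  apply: cells_le_cover => [|k _|z]; [by rewrite filter_uniq|exact: ab|].
  by rewrite mem_filter => /andP[/asboolP zS _] x /zS /cov[k _ ?]; exists k.
have vfin : vol S \is a fin_num.
  by rewrite ge0_fin_numE ?vol_ge0// (le_lt_trans vol_up)// ltry.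
exists (fine (vol S)); first by rewrite fineK.
move: vol_up vol_lo; rewrite -(fineK vfin) !lee_fin /= => v1 v2.
have /andP[c1 c2] := count_inside.
rewrite -cardT; apply: (@le_trans _ _ ((size s)%:R - (count inside s)%:R)); last first.
  by rewrite -natrB ?count_size// ler_nat.
move: c1 c2; rewrite -2!(ler_nat R) => c1 c2.
rewrite ler_norml opprB; apply/andP; split; first exact: lerB.
exact: lerB.
Qed.

(** * Counting lattice points *)

Lemma enorm_le_diam (R : realType) D (S : set 'rV[R]_D) (x y : 'rV[R]_D) :
  diam S \is a fin_num -> S x -> S y -> enorm (x - y) <= fine (diam S).
Proof.
move=> dfin Sx Sy; rewrite -lee_fin fineK// /diam le_max; apply/orP; right.
by apply: ereal_sup_ubound; exists x, y.
Qed.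

Lemma diam_le (R : realType) D (S : set 'rV[R]_D) (r : R) : 0 <= r ->
  (forall x y, S x -> S y -> enorm (x - y) <= r) -> (diam S <= r%:E)%E.
Proof.
move=> r0 Sr; rewrite /diam ge_max lee_fin r0/=.
by apply: ge_ereal_sup => _ [x [y [Sx Sy ->]]]; rewrite lee_fin; exact: Sr.
Qed.

Lemma diam_ge0 (R : realType) D (S : set 'rV[R]_D) : (0 <= diam S)%E.
Proof. by rewrite /diam le_max lexx. Qed.

Lemma counting_seq (T : choiceType) (R : realType) (s : seq T) : uniq s ->
  counting [set` s] = (size s)%:R%:E :> \bar R.
Proof.
move=> us; have fs : finite_set [set` s] by apply/finite_seqP; exists s.
rewrite /counting asboolT//; congr (_%:R%:E).
have -> : fset_set [set` s] = seq_fset tt s.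
  by apply/fsetP => x; rewrite in_fset_set// seq_fsetE; apply/idP/idP; rewrite inE.
by rewrite size_seq_fset undup_id.
Qed.

Lemma unimodular_lattice_basis (R : realType) D (G : set 'rV[R]_D) A (U : 'M[int]_D) :
  U \in unitmx -> lattice_basis G A -> lattice_basis G (map_mx intr U *m A).
Proof.
move=> Uu [Au ->]; have UuR : map_mx intr U \in @unitmx R D.
  by rewrite unitmxE det_map_mx rmorph_unit -?unitmxE.
split; first by rewrite unitmx_mul UuR.
apply/seteqP; split=> _ [z _ <-].
  by exists (z *m invmx U) => //; rewrite mulmxA -map_mxM mulmxKV.
by exists (z *m U) => //; rewrite map_mxM mulmxA.
Qed.

Lemma norm_det_unimodular (R : realType) D (U : 'M[int]_D) :
  U \in unitmx -> `|\det (map_mx intr U : 'M[R]_D)| = 1.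
Proof.
rewrite unitmxE => Uu; rewrite det_map_mx.
rewrite -intr_norm; have -> : `|\det U| = 1; last by [].
by case/orP: (Uu : (\det U == 1) || (\det U == -1)) => /eqP->.
Qed.

(* The error is measured in the coordinates of a reduced basis, where the image
   of Z is small because the lattice has no short vector. *)
Lemma lattice_point_count (R : realType) D (G Z : set 'rV[R]_D) (A T : 'M[R]_D)
    (kappa mu rho : R) (M : nat) :
  (0 < D)%N -> lattice_basis G A -> 0 <= kappa -> 0 < mu -> 0 <= rho ->
  lip_family kappa M Z ->
  (forall y, G y -> y != 0 -> mu <= sqn (y *m T)) ->
  (forall x y, Z x -> Z y -> (reduction_const D)%:R * sqn ((x - y) *m T) <= mu * rho ^+ 2) ->
  (`|counting (Z `&` G) - vol Z / `|\det A|%:E| <=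
    (M%:R * (kappa * rho + 1) ^+ D.-1 * (2 * D.-1).+1%:R ^+ D)%:E)%E.
Proof.
case: D G Z A T => // d G Z A T _ GA kappa0 mu0 rho0 Zlip Gmu Zrho.
have [U [Uu redU]] : exists U : 'M[int]_d.+1, U \in unitmx /\ forall x : 'rV[R]_d.+1,
    mu * sqn x <= (reduction_const d.+1)%:R * sqn (x *m (map_mx intr U *m (A *m T))).
  apply: reduced_basis => // z z0; rewrite mulmxA; apply: Gmu.
    by rewrite GA.2; exists z.
  apply: contra_neq z0 => zA0.
  have : map_mx intr z = 0 :> 'rV[R]_d.+1 by rewrite -(mulmxK GA.1 (map_mx _ z)) zA0 mul0mx.
  by move/rowP => z0; apply/rowP => i; have := z0 i; rewrite !mxE => /eqP; rewrite intr_eq0 => /eqP.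
have [Wu GW] := unimodular_lattice_basis Uu GA.
have detW : `|\det (map_mx intr U *m A)| = `|\det A|.
  by rewrite det_mulmx normrM norm_det_unimodular// mul1r.
(* [W] is a basis of [G] whose image under [T] is reduced, and [S] below is [Z] in coordinates with
   respect to [W]: points of [G] in [Z] become integer points of [S]. The Lipschitz hypothesis is
   used for the matrix [invmx W]. *)
move: redU Wu GW detW; set W := map_mx intr U *m A => redU Wu GW detW.
have Wu' : invmx W \in unitmx by rewrite unitmx_inv.
have := Zlip _ Wu'; set S := _ @` Z => -[dfin lipS].
have SZ x : S x <-> Z (x *m W).
  split=> [[z Zz <-]|Zx]; first by rewrite mulmxKV.
  by exists (x *m W); rewrite ?mulmxK.
have dS : fine (diam S) <= rho.
  rewrite -lee_fin fineK//; apply: diam_le => // x y /SZ Zx /SZ Zy.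
  rewrite -(@ler_pXn2r _ 2)// ?nnegrE ?enorm_ge0// sqr_enorm -(ler_pM2l mu0).
  apply: le_trans (redU _) _.
  have -> : (x - y) *m (map_mx intr U *m (A *m T)) = (x *m W - y *m W) *m T.
    by rewrite -mulmxBl /W !mulmxA.
  exact: Zrho.
have dS0 : 0 <= fine (diam S) by rewrite fine_ge0// diam_ge0.
have [r Sr] : exists r : R, forall x, S x -> forall i, `|x ord0 i| <= r.
  have [[x0 Sx0]|S0] := pselect (exists x, S x); last by exists 0 => x Sx; case: S0; exists x.
  exists (enorm x0 + fine (diam S)) => x Sx i.
  rewrite -[x](subrK x0) addrC mxE (le_trans (ler_normD _ _))// lerD ?coord_le_enorm//.
  by rewrite (le_trans (coord_le_enorm _ _))// enorm_le_diam.
have L0 : 0 <= kappa * fine (diam S) by rewrite mulr_ge0.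
have [s [us sS [v vS hv]]] := int_points_vol_le Sr L0 lipS.
have -> : counting (Z `&` G) = (size s)%:R%:E :> \bar R.
  have inj : injective (fun z : 'rV[int]_d.+1 => map_mx intr z *m W : 'rV[R]_d.+1).
    move=> z z' /(can_inj (mulmxK Wu))/rowP zz'; apply/rowP => i.
    by have := zz' i; rewrite !mxE => /eqP; rewrite eqr_int => /eqP.
  rewrite -(size_map (fun z : 'rV[int]_d.+1 => map_mx intr z *m W : 'rV[R]_d.+1)).
  rewrite -counting_seq ?map_inj_uniq//; congr counting.
  rewrite GW; apply/seteqP; split=> [x [Zx [z _ zx]]|_ /mapP[z /sS Sz ->]].
    by rewrite -zx; apply: map_f; apply/sS/SZ; rewrite zx.
  by split; [exact/SZ|exists z].
have dW0 : `|\det A| != 0 by rewrite -detW normr_eq0 -unitfE -unitmxE.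
have -> : (vol Z / `|\det A|%:E)%E = v%:E.
  rewrite -vS inver (negbTE dW0) muleC -detW -normfV -det_inv.
  exact/esym/(vol_linear Z Wu').
rewrite -EFinB abse_EFin lee_fin (le_trans hv)// !natrM !natrX.
rewrite ler_wpM2r// ler_wpM2l// lerXn2r ?nnegrE// ?addr_ge0// ?mulr_ge0//.
rewrite -natr1 lerD2r (le_trans _ (ler_wpM2l kappa0 dS))//.
by have /andP[] := truncn_itv L0.
Qed.

(** * Block scaling *)

Section block_scaling.
Variables (R : realType) (n : nat) (m : 'I_n -> nat).
Implicit Types (x : 'rV[R]_(\sum_i m i)) (theta Q beta : 'I_n -> R).

Lemma sqn_blocks x : sqn x = \sum_i sqn (submxrow x i).
Proof.
have sqnE D (y : 'rV[R]_D) : sqn y = (y *m y^T) ord0 ord0.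
  by rewrite mxE; apply: eq_bigr => j _; rewrite mxE expr2.
rewrite sqnE -{1 2}[x]submxrowK tr_mxrow mul_mxrow_mxcol summxE.
by apply: eq_bigr => i _; rewrite sqnE.
Qed.

Definition block_scale theta : 'M[R]_(\sum_i m i) :=
  \mxdiag_i (theta i)%:M.

Lemma submxrow_block_scale theta x i :
  submxrow (x *m block_scale theta) i = theta i *: submxrow x i.
Proof.
by rewrite -{1}[x]submxrowK mul_mxrow_mxdiag mxrowK mul_mx_scalar.
Qed.

Lemma sqn_block_scale theta x :
  sqn (x *m block_scale theta) = \sum_i theta i ^+ 2 * sqn (submxrow x i).
Proof.
by rewrite sqn_blocks; apply: eq_bigr => i _; rewrite submxrow_block_scale sqnZ.
Qed.

Lemma block_le_enorm x i : enorm (submxrow x i) <= enorm x.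
Proof.
rewrite ler_wsqrtr// -/(sqn x) -/(sqn (submxrow x i)) sqn_blocks (bigD1 i)//= lerDl.
by apply: sumr_ge0 => j _; exact: sqn_ge0.
Qed.

Lemma enormZ D (c : R) (x : 'rV[R]_D) : enorm (c *: x) = `|c| * enorm x.
Proof. by rewrite !enormE sqnZ sqrtrM ?sqr_ge0// sqrtr_sqr. Qed.

Lemma enorm_gt0 D (x : 'rV[R]_D) : x != 0 -> 0 < enorm x.
Proof.
move=> x0; rewrite lt_neqAle enorm_ge0 andbT eq_sym -sqrf_eq0 sqr_enorm.
by apply: contra_neq x0; exact: sqn_eq0.
Qed.

Lemma powR_sum_exp (c : R) (I : Type) (s : seq I) (b : I -> R) : 0 < c ->
  \prod_(i <- s) c `^ b i = c `^ \sum_(i <- s) b i.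
Proof.
move=> c0; elim: s => [|i s IH]; first by rewrite !big_nil powRr0.
by rewrite !big_cons IH powRD//; apply/implyP => _; rewrite gt_eqF.
Qed.

Lemma Qbar_gt0 beta Q : (forall i, 0 < Q i) -> 0 < Qbar beta Q.
Proof. by move=> Q0; apply: powR_gt0; apply: prodr_gt0 => i _; exact: powR_gt0. Qed.

(** The hypothesis bounds the i-th block by (c/q) Q_i with q = [Qbar beta Q]. As q is the weighted
    geometric mean of the Q_i, the weighted geometric mean of these bounds is exactly c. *)
Lemma Nm_le beta Q x (c : R) : (forall i, 0 < beta i) -> 0 < \sum_i beta i ->
  (forall i, 0 < Q i) -> 0 < c ->
  (forall i, Qbar beta Q / Q i * enorm (submxrow x i) <= c) ->
  Nm beta x `^ (\sum_i beta i)^-1 <= c.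
Proof.
move=> b0 t0 Q0 c0 hc; have q0 := Qbar_gt0 beta Q0.
set t := \sum_i beta i in t0 *; set q := Qbar beta Q in hc q0.
have -> : c = ((c / q) `^ t * \prod_i Q i `^ beta i) `^ t^-1.
  rewrite powRM ?powR_ge0//; last by apply: prodr_ge0 => i _; exact: powR_ge0.
  rewrite -powRrM mulfV ?gt_eqF// powRr1; last by rewrite divr_ge0 ?ltW.
  by rewrite -/(Qbar beta Q) -/q divfK// gt_eqF.
apply: ge0_ler_powR; rewrite ?invr_ge0 ?(ltW t0)// ?nnegrE.
- by apply: prodr_ge0 => i _; exact: powR_ge0.
- by rewrite mulr_ge0 ?powR_ge0// prodr_ge0// => i _; exact: powR_ge0.
rewrite -powR_sum_exp ?divr_gt0// -big_split/=; apply: ler_prod => i _.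
rewrite powR_ge0/= -powRM ?divr_ge0 ?(ltW c0) ?(ltW q0) ?(ltW (Q0 i))//.
apply: ge0_ler_powR; rewrite ?nnegrE ?enorm_ge0 ?(ltW (b0 i))//.
  by rewrite mulr_ge0 ?divr_ge0// ltW.
by rewrite mulrAC ler_pdivlMr// mulrC -ler_pdivrMr// mulrAC.
Qed.
End block_scaling.

(** * Short vectors of the scaled lattice and diameter of the scaled set *)

Section scaled_lattice.
Variables (R : realType) (n : nat) (m : 'I_n -> nat) (beta Q : 'I_n -> R).
Variables (I : {set 'I_n}) (G : set 'rV[R]_(\sum_i m i)).
Hypotheses (n_gt0 : (0 < n)%N) (beta_gt0 : forall i, 0 < beta i).
Hypotheses (Q_gt0 : forall i, 0 < Q i)
  (Q_le : forall i, i \notin I -> Q i <= Qbar beta Q).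

Let q := Qbar beta Q.
Let T : 'M[R]_(\sum_i m i) := block_scale m (fun i => q / Q i).
Let q_gt0 : 0 < q := Qbar_gt0 beta Q_gt0.

Let theta_gt0 i : 0 < q / Q i.
Proof. by rewrite divr_gt0. Qed.

Lemma mu_ge0 (B : R) : (0 <= mu beta I G B)%E.
Proof.
rewrite /mu le_min; apply/andP; split; apply: le_ereal_inf_tmp.
  by move=> _ [x _ <-]; rewrite lee_fin enorm_ge0.
by move=> _ [x _ <-]; rewrite lee_fin powR_ge0.
Qed.

Let block_le_scaled (x : 'rV[R]_(\sum_i m i)) i : q / Q i * enorm (submxrow x i) <= enorm (x *m T).
Proof.
have := block_le_enorm (x *m T) i; rewrite submxrow_block_scale enormZ.
by rewrite gtr0_norm.
Qed.

Let le_enorm_scaled (x : 'rV[R]_(\sum_i m i)) :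
  (forall i, enorm (submxrow x i) <= q / Q i * enorm (submxrow x i)) ->
  enorm x <= enorm (x *m T).
Proof.
move=> hx; rewrite ler_wsqrtr// -/(sqn x) -/(sqn (x *m T)) sqn_blocks sqn_block_scale.
apply: ler_sum => i _; rewrite -sqr_enorm -exprMn ler_pXn2r ?nnegrE ?enorm_ge0//.
by rewrite mulr_ge0 ?enorm_ge0// ltW.
Qed.

Let scaled_neq0 (x : 'rV[R]_(\sum_i m i)) : x != 0 -> x *m T != 0.
Proof.
apply: contra_neq => xT; apply: sqn_eq0; rewrite sqn_blocks big1// => i _.
have := block_le_scaled x i; rewrite xT [enorm 0]enormE sqn0 sqrtr0.
rewrite pmulr_rle0// => xi; rewrite -sqr_enorm.
by apply/eqP; rewrite sqrf_eq0 eq_le xi enorm_ge0.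
Qed.

Lemma mu_le_enorm_scaled (B : R) y : G y -> y != 0 -> @Cset R n m I y \/ enorm y < B ->
  (mu beta I G B <= (enorm (y *m T))%:E)%E.
Proof.
move=> Gy y0 hy; rewrite /mu ge_min; apply/orP.
have [Cy|Cy] := pselect (@Cset R n m I y).
  left; apply: (@le_trans _ _ (enorm y)%:E).
    by apply: ereal_inf_lbound; exists y => //; split=> //; exact/eqP.
  rewrite lee_fin le_enorm_scaled// => i.
  (* Blocks with index in [I] vanish on C; the others are multiplied by q / Q_i >= 1, by [Q_le]. *)
  have [iI|iI] := boolP (i \in I).
    by rewrite Cy// /enorm big1 ?sqrtr0 ?mulr0// => j _; rewrite mxE expr0n.
  by rewrite ler_peMl ?enorm_ge0// ler_pdivlMr// mul1r Q_le.
right; case: hy => // yB; apply: (@le_trans _ _ (Nm beta y `^ (\sum_i beta i)^-1)%:E).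
  by apply: ereal_inf_lbound; exists y.
have t0 : 0 < \sum_i beta i.
  rewrite (bigD1 (Ordinal n_gt0))//= ltr_pwDl// sumr_ge0// => i _; exact: ltW.
rewrite lee_fin; apply: (Nm_le beta_gt0 t0 Q_gt0); last exact: block_le_scaled.
exact/enorm_gt0/scaled_neq0.
Qed.

Lemma Qbar_le_enorm_scaled (B X : R) y : 0 < B ->
  (q%:E / mu beta I G B + (Qmax Q / B)%:E)%E = X%:E ->
  G y -> y != 0 -> q <= X * enorm (y *m T).
Proof.
move=> B0 XE Gy y0.
have Qm i : Q i <= Qmax Q by exact: le_bigmax.
have Qm0 : 0 < Qmax Q by exact: lt_le_trans (Qm (Ordinal n_gt0)).
have Ty0 : 0 < enorm (y *m T) by exact/enorm_gt0/scaled_neq0.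
have mu0 := mu_ge0 B.
have XB : Qmax Q / B <= X.
  by rewrite -lee_fin -XE leeDr// mule_ge0 ?inve_ge0// lee_fin ltW.
have [hy|hy] := pselect (@Cset R n m I y \/ enorm y < B).
  have := mu_le_enorm_scaled Gy y0 hy; move: XE mu0.
  case: (mu beta I G B) => [r| |]//= XE; rewrite !lee_fin => r0 ry.
  (* If mu were 0 then q / mu would be +oo, against the finiteness of [X]. *)
  have [r_eq0|r_neq0] := eqVneq r 0.
    by move: XE; rewrite r_eq0 inve0 gt0_muley ?lte_fin// addye.
  have rgt0 : 0 < r by rewrite lt_neqAle eq_sym r_neq0.
  move: XE; rewrite inver (negbTE r_neq0) -EFinM -EFinD => -[XE].
  apply: (@le_trans _ _ (X * r)); last by rewrite ler_wpM2l// (le_trans _ XB)// divr_ge0 ?ltW.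
  rewrite -ler_pdivrMr// -XE lerDl divr_ge0 ?ltW//.
have /not_orP[_ /negP] := hy; rewrite -leNgt => By.
(* For a long vector it is enough that every scaling factor q / Q_i is at least q / Qmax. *)
apply: (@le_trans _ _ (Qmax Q / B * (q / Qmax Q * enorm y))).
  have -> : Qmax Q / B * (q / Qmax Q * enorm y) = q * (enorm y / B).
    by field; rewrite !gt_eqF.
  by rewrite ler_peMr ?(ltW q_gt0)// ler_pdivlMr// mul1r.
have QB0 : 0 <= Qmax Q / B by rewrite divr_ge0 ?ltW.
have qy0 : 0 <= q / Qmax Q * enorm y by rewrite mulr_ge0 ?enorm_ge0// divr_ge0 ?ltW.
apply: ler_pM => //; rewrite -(@ler_pXn2r _ 2)// ?nnegrE ?enorm_ge0//.
rewrite exprMn !sqr_enorm sqn_blocks sqn_block_scale mulr_sumr.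
apply: ler_sum => i _; rewrite ler_wpM2r ?sqn_ge0// lerXn2r ?nnegrE ?(ltW (theta_gt0 _))//.
  by rewrite divr_ge0 ?ltW.
by rewrite ler_pM2l// lef_pV2 ?posrE.
Qed.

Lemma sqn_scaled_diff_le (Z : set 'rV[R]_(\sum_i m i)) x y :
  (forall i, exists c : 'rV[R]_(m i), forall z, Z z -> enorm (submxrow z i - c) <= Q i) ->
  Z x -> Z y -> sqn ((x - y) *m T) <= n%:R * (2 * q) ^+ 2.
Proof.
move=> hZ Zx Zy; rewrite sqn_block_scale.
apply: (@le_trans _ _ (\sum_(i < n) (2 * q) ^+ 2)); last first.
  by rewrite sumr_const card_ord -[leLHS]mulr_natl.
apply: ler_sum => i _; have [c hc] := hZ i.
have h D (u v : 'rV[R]_D) (r : R) : enorm u <= r -> enorm v <= r -> sqn (u - v) <= (2 * r) ^+ 2.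
  move=> ur vr; have r0 : 0 <= r by rewrite (le_trans (enorm_ge0 u)).
  have ur2 : sqn u <= r ^+ 2 by rewrite -sqr_enorm ler_pXn2r ?nnegrE ?enorm_ge0.
  have vr2 : sqn v <= r ^+ 2 by rewrite -sqr_enorm ler_pXn2r ?nnegrE ?enorm_ge0.
  have uv : sqn (u - v) <= 2 * sqn u + 2 * sqn v.
    rewrite /sqn !mulr_sumr -big_split/=; apply: ler_sum => j _; rewrite !mxE.
    rewrite -subr_ge0 (_ : _ - _ = (u ord0 j + v ord0 j) ^+ 2) ?sqr_ge0//; ring.
  rewrite (le_trans uv)// exprMn (_ : 2 ^+ 2 * r ^+ 2 = 2 * r ^+ 2 + 2 * r ^+ 2); last by ring.
  by rewrite lerD// ler_wpM2l.
have -> : submxrow (x - y) i = (submxrow x i - c) - (submxrow y i - c).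
  by rewrite submxrowB opprB addrA subrK.
have := h _ _ _ _ (hc _ Zx) (hc _ Zy); set w := sqn _ => hw.
apply: (@le_trans _ _ ((q / Q i) ^+ 2 * (2 * Q i) ^+ 2)).
  by rewrite ler_wpM2l// sqr_ge0.
rewrite -exprMn (_ : q / Q i * (2 * Q i) = 2 * q)//.
by field; rewrite gt_eqF.
Qed.
End scaled_lattice.

(** * Comparison of the constants with [c1] *)

(** At N = 2 this is 6 <= 8. From N to N + 1 the left side gains the factor N + 2, the right side at
    least (N + 1)^2. *)
Lemma red_const_le N : (1 < N)%N -> (reduction_const N <= N ^ (2 * N).-1)%N.
Proof.
case: N => // -[//|N _]; elim: N => [//|N IH].
apply: (@leq_trans (N.+4 * N.+2 ^ (2 * N.+2).-1)); first by rewrite /= leq_mul2l IH orbT.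
have -> : (2 * N.+3).-1 = (2 + (2 * N.+2).-1)%N by lia.
rewrite expnD; apply: leq_mul; first by nia.
by rewrite leq_exp2r//; lia.
Qed.

(** The scaled set has squared diameter at most 4 n Qbar^2; with 2 <= N and n <= N, this gives
    diameter at most N^(N+1) X in reduced coordinates. *)
Lemma diam_const_le (R : realType) N n : (1 < N)%N -> (n <= N)%N ->
  (reduction_const N)%:R * (n%:R * 2 ^+ 2) <= (N%:R ^+ N.+1) ^+ 2 :> R.
Proof.
move=> N1 nN; rewrite -!natrX -!natrM ler_nat.
apply: (@leq_trans (N ^ (2 * N).-1 * (N * N ^ 2))).
  by apply: leq_mul; [exact: red_const_le|apply: leq_mul => //; rewrite leq_exp2r].
rewrite -expnS -expnD -expnM leq_pexp2l//; lia.
Qed.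

Lemma count_const_le (R : realType) N M (kappa X : R) : (1 < N)%N ->
  0 <= kappa -> 1 <= X ->
  M%:R * (kappa * (N%:R ^+ N.+1 * X) + 1) ^+ N.-1 * (2 * N.-1).+1%:R ^+ N <=
  c1 N M kappa * X ^+ N.-1.
Proof.
move=> N1 k0 X1; rewrite /c1 -!mulrA ler_wpM2l//.
have N1R : 1 <= N%:R :> R by rewrite ler1n ltnW.
have NN1 : 1 <= N%:R ^+ N.+1 :> R by rewrite exprn_ege1.
have X0 : 0 <= X by rewrite (le_trans _ X1).
have h1 : kappa * (N%:R ^+ N.+1 * X) + 1 <= (1 + kappa) * N%:R ^+ N.+1 * X.
  rewrite -mulrA [leRHS]mulrDl mul1r addrC lerD2r.
  by rewrite -[leLHS]mulr1 ler_pM.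
have h2 : (2 * N.-1).+1%:R <= N%:R ^+ 2 :> R.
  by rewrite -natrX ler_nat; nia.
apply: (@le_trans _ _ (((1 + kappa) * N%:R ^+ N.+1 * X) ^+ N.-1 * (N%:R ^+ 2) ^+ N)).
  have a0 : 0 <= kappa * (N%:R ^+ N.+1 * X) + 1.
    by rewrite addr_ge0// mulr_ge0// mulr_ge0// exprn_ge0.
  apply: ler_pM; [exact: exprn_ge0|exact: exprn_ge0| |].
    by rewrite lerXn2r// nnegrE// (le_trans a0).
  by rewrite lerXn2r ?nnegrE ?exprn_ge0//.
have K0 : 1 <= 1 + kappa by rewrite lerDl.
have K0' : 0 <= 1 + kappa by rewrite addr_ge0.
rewrite !exprMn [leLHS]mulrAC ler_wpM2r ?exprn_ge0// -[leLHS]mulrA.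
apply: ler_pM; [exact: exprn_ge0|by rewrite mulr_ge0 ?exprn_ge0| |].
  by rewrite ler_weXn2l// leq_pred.
(* The exponents of N satisfy (N + 1)(N - 1) + 2N <= 2N^2, that is, (N - 1)^2 >= 0. *)
rewrite -!exprM -!exprD ler_weXn2l//.
by clear -N1; case: N N1 => // k _ /=; nia.
Qed.

Lemma expey (R : realType) k : (+oo ^+ k.+1 = +oo :> \bar R)%E.
Proof. by elim: k => [|k IH]; rewrite expeS ?expe0 ?mule1// IH mulyy. Qed.

(* In \bar R, +oo^-1 = 0, which is the convention for 1 / mu.  [counting] is the
   cardinality of a set, with value +oo for an infinite set. *)
Theorem theorem2p1 (R : realType) (n : nat) (m : 'I_n -> nat)
    (beta : 'I_n -> R) (I : {set 'I_n}) (Q : 'I_n -> R) (kappa : R) (M : nat)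
    (Lambda Z : set 'rV[R]_(\sum_i m i))
    (n_ge1 : (1 <= n)%N)
    (m_gt0 : forall i, (0 < m i)%N)
    (beta_gt0 : forall i, 0 < beta i)
    (N_gt1 : (1 < \sum_i m i)%N)
    (Q_gt0 : forall i, 0 < Q i)
    (Q_le : forall i, i \notin I -> Q i <= Qbar beta Q)
    (kappa_gt0 : 0 < kappa)
    (M_gt0 : (0 < M)%N)
    (Lambda_adm : weakly_admissible beta I Lambda)
    (Z_lip : lip_family kappa M Z)
    (Z_ball : forall i, exists y : 'rV[R]_(m i),
       forall z, Z z -> enorm (submxrow z i - y) <= Q i) :
  (`| counting (Z `&` Lambda) - vol Z / (det_lattice Lambda)%:E |
     <= (c1 (\sum_i m i) M kappa)%:E *
        ereal_inf [set ((Qbar beta Q)%:E / mu beta I Lambda B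
                          + (Qmax Q / B)%:E) ^+ (\sum_i m i)%N.-1 |
                   B in [set B : R | (0 < B <= Qmax Q)%R]])%E.
Proof.
have [[A0 GA0] nu0] := Lambda_adm.
have GA : lattice_basis Lambda (xget 1%:M (lattice_basis Lambda)) by apply: xgetPex; exists A0.
have Qm i : Q i <= Qmax Q by exact: le_bigmax.
have c0 : 0 < c1 (\sum_i m i) M kappa.
  rewrite /c1 mulr_gt0 ?ltr0n// exprn_gt0// mulr_gt0 ?addr_gt0// exprn_gt0// ltr0n.
  exact: ltnW.
have q0 : 0 < Qbar beta Q by exact: Qbar_gt0.
have nN : (n <= \sum_i m i)%N.
  by rewrite -[leqLHS]card_ord -sum1_card leq_sum.
rewrite -lee_pdivrMl//; apply: le_ereal_inf_tmp => _ [B /andP[B0 BQ] <-].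
rewrite lee_pdivrMl//.
(* B <= Qmax makes the second term at least 1; this later absorbs the additive 1 in the number of
   subcubes. *)
have X1 : (1%:E <= (Qbar beta Q)%:E / mu beta I Lambda B + (Qmax Q / B)%:E)%E.
  rewrite (@le_trans _ _ (Qmax Q / B)%:E)//; first by rewrite lee_fin ler_pdivlMr// mul1r.
  by rewrite leeDr// mule_ge0 ?inve_ge0 ?mu_ge0// lee_fin ltW.
case XE : (_ / mu beta I Lambda B + _)%E X1 => [X| |]//; last first.
  (* N > 1 makes the exponent positive; a zeroth power of +oo would be 1, not +oo. *)
  have -> : (\sum_i m i).-1 = (\sum_i m i).-2.+1 by lia.
  by move=> _; rewrite expey gt0_muley ?lte_fin// leey.
rewrite lee_fin => X1; have X0 : 0 < X by exact: lt_le_trans X1.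
rewrite -EFin_expe -EFinM.
(* Nonzero vectors of the scaled lattice have length at least Qbar / X, and N^(N+1) X bounds the
   diameter in reduced coordinates. *)
apply: le_trans (@lattice_point_count _ _ Lambda Z _ (block_scale m (fun i => Qbar beta Q / Q i))
  kappa ((Qbar beta Q / X) ^+ 2) ((\sum_i m i)%:R ^+ (\sum_i m i).+1 * X) M _ GA _ _ _ Z_lip _ _) _.
- exact: ltnW.
- exact: ltW.
- by rewrite exprn_gt0// divr_gt0.
- by rewrite mulr_ge0 ?exprn_ge0// ltW.
- move=> y Gy y0; rewrite -sqr_enorm lerXn2r ?nnegrE ?enorm_ge0//; first by rewrite divr_ge0 ?ltW.
  rewrite ler_pdivrMr// mulrC.
  exact: (Qbar_le_enorm_scaled n_ge1 beta_gt0 Q_gt0 Q_le B0 XE Gy y0).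
- move=> x y Zx Zy.
  apply: (@le_trans _ _ ((reduction_const (\sum_i m i))%:R * (n%:R * (2 * Qbar beta Q) ^+ 2))).
    by rewrite ler_wpM2l//; exact: (sqn_scaled_diff_le beta Q_gt0 Z_ball Zx Zy).
  rewrite [(2 * _) ^+ 2]exprMn [X in X <= _]mulrA [X in X <= _]mulrA -[_ * n%:R * _]mulrA.
  have -> : (Qbar beta Q / X) ^+ 2 * ((\sum_i m i)%:R ^+ (\sum_i m i).+1 * X) ^+ 2 =
      ((\sum_i m i)%:R ^+ (\sum_i m i).+1) ^+ 2 * Qbar beta Q ^+ 2.
    by rewrite -!exprMn mulrCA divfK// gt_eqF.
  by rewrite ler_wpM2r ?sqr_ge0//; exact: diam_const_le.
by rewrite lee_fin; apply: count_const_le => //; exact: ltW.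
Qed.
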